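(* Fix an integer $k \ge 2$, reals $2 > \alpha > \beta \ge 1$, and let $\mathcal{F}$ be an $(\alpha,\beta)$-quasi-smooth family of bipartite graphs. For any $\epsilon, C > 0$ there exist $n_0, \delta > 0$ such that for every integer $n \ge n_0$, every $\mathcal{F}$-free $n$-vertex graph $G$ with $$\mathrm{Hom}(C_{2k}, G) \le C n^{2k(\alpha-1)} \qquad\text{and}\qquad \mathrm{Inj}(C_{2k+1}, G) \le \delta n^{(2k+1)(\alpha-1)}$$ can be made $\{C_3, C_5, \ldots, C_{2k+1}\}$-free by removing at most $\epsilon n^{\alpha}$ edges.
   Context: Graphs are finite, unweighted, undirected and simple. $C_m$ is the cycle of length $m$. $\mathrm{Hom}(H,G)$ is the number of graph homomorphisms from $H$ to $G$, and $\mathrm{Inj}(H,G)$ is the number of injective ones. A graph is $\mathcal{F}$-free if it contains no subgraph isomorphic to a member of $\mathcal{F}$. For a family $\mathcal{F}$ of bipartite graphs, $\mathrm{ex}(m,n,\mathcal{F})$ denotes the maximal number of edges in an $\mathcal{F}$-free bipartite graph with parts of sizes $m$ and $n$. For reals $2>\alpha>\beta\ge1$, the family $\mathcal{F}$ is $(\alpha,\beta)$-quasi-smooth if there is a constant $c>0$ such that $\mathrm{ex}(m,n,\mathcal{F}) \le c\,(m n^{\alpha-1} + n^{\beta})$ for all integers $n \ge m \ge 1$. *)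

(* Defs.v *)
From HB Require Import structures.
From mathcomp Require Import all_boot all_order all_algebra.
From mathcomp Require Import boolp reals exp.

Set Implicit Arguments.
Unset Strict Implicit.
Unset Printing Implicit Defensive.

Import Order.TTheory GRing.Theory Num.Theory.

Record sgraph := SGraph {
  vertex :> finType;
  adj : rel vertex;
  adj_sym : symmetric adj;
  adj_irr : irreflexive adj
}.

Definition edges (G : sgraph) : {set {set G}} :=
  [set [set p.1; p.2] | p : G * G & adj p.1 p.2].

Definition is_hom (H G : sgraph) (f : H -> G) : bool :=
  [forall x, forall y, adj x y ==> adj (f x) (f y)].

Definition num_hom (H G : sgraph) : nat := #|[set f : {ffun H -> G} | is_hom f]|.

Definition num_inj (H G : sgraph) : nat :=
  #|[set f : {ffun H -> G} | is_hom f && injectiveb f]|.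

(* Not necessarily induced. *)
Definition contains_copy (G H : sgraph) : Prop :=
  exists f : H -> G, injective f /\ is_hom f.

Definition graph_family := sgraph -> Prop.

Definition family_free (F : graph_family) (G : sgraph) : Prop :=
  forall H, F H -> ~ contains_copy G H.

Definition bipartite (G : sgraph) : Prop :=
  exists c : G -> bool, forall x y, adj x y -> c x != c y.

Section Cycle.
Variable m : nat.

(* For m < 3 this is not a cycle; the condition i != j only serves to keep the
   relation irreflexive when m = 1. *)
Definition cycle_adj (i j : 'I_m) : bool :=
  (i != j) && ((j == ordS i) || (i == ordS j)).

Lemma cycle_adj_sym : symmetric cycle_adj.
Proof. by move=> i j; rewrite /cycle_adj eq_sym orbC. Qed.

Lemma cycle_adj_irr : irreflexive cycle_adj.
Proof. by move=> i; rewrite /cycle_adj eqxx. Qed.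

Definition cycle_graph : sgraph := SGraph cycle_adj_sym cycle_adj_irr.

End Cycle.

(* C_3, C_5, ..., C_{2k+1}. *)
Definition odd_cycles (k : nat) : graph_family :=
  fun H => exists2 l, 1 <= l <= k & H = cycle_graph (2 * l + 1).

Section DeleteEdges.
Variables (G : sgraph) (D : {set {set G}}).

Definition del_adj (x y : G) : bool := adj x y && ([set x; y] \notin D).

Lemma del_adj_sym : symmetric del_adj.
Proof. by move=> x y; rewrite /del_adj adj_sym setUC. Qed.

Lemma del_adj_irr : irreflexive del_adj.
Proof. by move=> x; rewrite /del_adj adj_irr. Qed.

Definition del_edges : sgraph := SGraph del_adj_sym del_adj_irr.

End DeleteEdges.

Section BipartiteGraph.
Variables (m n : nat) (E : {set 'I_m * 'I_n}).

Definition bip_adj (x y : 'I_m + 'I_n) : bool :=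
  match x, y with
  | inl i, inr j | inr j, inl i => (i, j) \in E
  | _, _ => false
  end.

Lemma bip_adj_sym : symmetric bip_adj.
Proof. by case=> x; case=> y. Qed.

Lemma bip_adj_irr : irreflexive bip_adj.
Proof. by case. Qed.

Definition bip_graph : sgraph := SGraph bip_adj_sym bip_adj_irr.

End BipartiteGraph.

(* The maximum is 0 when no bipartite graph with parts of sizes m and n is
   F-free, which requires an edgeless member of F. *)
Definition ex_bip (m n : nat) (F : graph_family) : nat :=
  \max_(E : {set 'I_m * 'I_n} | `[< family_free F (bip_graph E) >])
    #|edges (bip_graph E)|.

Definition quasi_smooth (R : realType) (alpha beta : R) (F : graph_family) :
    Prop :=
  exists c : R, (0 < c)%R /\
    forall m n : nat, 1 <= m -> m <= n ->
      ((ex_bip m n F)%:R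
        <= c * (m%:R * n%:R `^ (alpha - 1) + n%:R `^ beta))%R.

(* Main.v *)
Require Import Defs.
From mathcomp Require Import all_boot all_order all_algebra.
From mathcomp Require Import boolp reals exp.
From mathcomp Require Import ring lra zify.
Import Order.TTheory GRing.Theory Num.Theory.
Local Open Scope ring_scope.
Set Implicit Arguments.
Unset Strict Implicit.
Unset Printing Implicit Defensive.

(** Write n for the number of vertices and d = n^(alpha-1) for the scale of the
    degrees, and view the graph as the kernel a = (n/d) adj, whose mean is
    bounded. The idea is to replace this sparse kernel by a bounded step kernel,
    for which removing edges and counting closed walks are elementary, and to
    carry the count back to the graph.

    Regularity. The sum of the square roots of the block means of a partition
    can only decrease under refinement, and its decrease controls the change of
    the block means on the blocks of bounded mean ([energy_drop]). Iteration
    yields a partition p with at most m parts and a refinement p' of p such that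
    the block means of p and p' are close in the mean, while a is close to its p'
    block means in cut norm, with a precision psi m that may be any function of m
    ([strong_regularity]).

    Removal. Delete the edges at vertices of degree much larger than d and the
    edges in those blocks of p that involve a small part, have a very small or a
    very large mean, or are not nearly homogeneous for p'. Quasi-smoothness enters
    here: a part S and the union B of the parts which form very dense blocks with
    it span at most about |S| |B|^(alpha-1) edges, where B must be small, so
    the very dense blocks contain few edges ([dense_blocks_few_edges]). It also
    disposes of the vertices of large degree ([high_degree_edges]).

    Counting. Suppose that an odd cycle of length at most 2k+1 survives. It
    extends to a closed walk with 2k+1 steps through good blocks of p
    ([odd_closed_walk]). In the parts along it choose disjoint sets; a
    union bound shows that the step kernel of p' has a positive density, in terms
    of m, of closed chains through them ([closed_chain_lower]). To transfer this
    to a, cut a closed chain into two k-chains and one edge. The bound on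
    Hom(C_2k, G) is a bound for the second moment of the k-chains, so these can be
    truncated, after which the closeness in cut norm replaces the edge and the two
    k-chains by those of the model ([counting_lemma]). Since psi m was free to
    depend on m, the errors stay below the density. Closed walks through
    disjoint sets are injective, so Inj(C_2k+1, G) is at least a positive
    multiple of d^(2k+1), which contradicts the hypothesis for small delta. *)

(** * Conditional means and their energy *)

Section FibreMean.
Variables (R : realFieldType) (Omega T : finType) (l : Omega -> T).
Implicit Types (a g : Omega -> R) (v w : Omega).

(** The conditional expectation of [a] given the label [l], for the uniform
    measure on [Omega]. *)
Definition fibre_mean a w : R :=
  (\sum_(v | l v == l w) a v) / (#|[pred v | l v == l w]|)%:R.

Lemma fibre_card_gt0 w : 0 < (#|[pred v | l v == l w]|)%:R :> R.
Proof. by rewrite ltr0n; apply/card_gt0P; exists w; rewrite inE. Qed.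

Lemma fibre_mean_ge0 a : (forall w, 0 <= a w) -> forall w, 0 <= fibre_mean a w.
Proof. by move=> a0 w; rewrite divr_ge0 ?ler0n ?sumr_ge0. Qed.

Lemma fibre_mean_fibre a v w : l v = l w -> fibre_mean a v = fibre_mean a w.
Proof. by rewrite /fibre_mean => ->. Qed.

(** The defining property of a conditional expectation. *)
Lemma sum_fibre_mean a g : (forall v w, l v = l w -> g v = g w) ->
  \sum_w g w * fibre_mean a w = \sum_w g w * a w.
Proof.
move=> gl.
have -> : \sum_w g w * fibre_mean a w =
    \sum_w \sum_(v | l v == l w)
      a v * g v / (#|[pred u | l u == l v]|)%:R.
  apply: eq_bigr => w _; rewrite /fibre_mean mulrA mulr_sumr mulr_suml.
  by apply: eq_bigr => v /eqP e; rewrite (gl _ _ (esym e)) e [g v * _]mulrC.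
rewrite (exchange_big_dep xpredT) //=; apply: eq_bigr => v _.
under eq_bigl do rewrite eq_sym.
rewrite sumr_const -[LHS]mulr_natr.
by rewrite divfK ?gt_eqF ?fibre_card_gt0 // mulrC.
Qed.

Lemma fibre_mean_eq0 a w : (forall v, 0 <= a v) -> fibre_mean a w = 0 ->
  forall v, l v = l w -> a v = 0.
Proof.
move=> a0 /eqP; rewrite mulf_eq0 invr_eq0 (gt_eqF (fibre_card_gt0 w)) orbF.
move=> /eqP s0 v lv.
by apply: (psumr_eq0P (P := fun v => l v == l w) _ s0) => //; apply/eqP.
Qed.

End FibreMean.

Section Energy.
Variables (R : rcfType) (Omega : finType).
Implicit Types (a : Omega -> R).

(** The index that measures the progress of refinement. It uses the square root
    instead of the usual square because the kernels of sparse graphs are bounded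
    in mean only: the square root is still strictly concave, and its sum is
    bounded by the mean alone. *)
Definition energy (T : finType) (l : Omega -> T) a : R :=
  \sum_w Num.sqrt (fibre_mean l a w).

Lemma energy_ge0 (T : finType) (l : Omega -> T) a : 0 <= energy l a.
Proof. by apply: sumr_ge0 => w _; apply: sqrtr_ge0. Qed.

Lemma energy_le (T : finType) (l : Omega -> T) a : (forall w, 0 <= a w) ->
  energy l a <= (#|Omega|)%:R + \sum_w a w.
Proof.
move=> a0.
have -> : \sum_w a w = \sum_w 1 * fibre_mean l a w.
  by rewrite sum_fibre_mean //; apply: eq_bigr => w _; rewrite mul1r.
rewrite -sum1_card natr_sum -big_split /=; apply: ler_sum => w _.
have := sqr_sqrtr (fibre_mean_ge0 l a0 w); rewrite mul1r => {2}<-.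
have := sqrtr_ge0 (fibre_mean l a w); nra.
Qed.

(** The gap in the tangent inequality for the square root at s^2, taken at t^2,
    equals (t - s)^2 / (2 s), and the arithmetic-geometric mean inequality
    compares it with |t^2 - s^2| = |t - s| (t + s). *)
Lemma sqrt_gap (s t lam : R) : 0 < s -> 0 <= t ->
  lam * `|t ^+ 2 - s ^+ 2| <=
  s - t + (t ^+ 2 - s ^+ 2) / (2 * s) + lam ^+ 2 * s * (t ^+ 2 + s ^+ 2).
Proof.
move=> s0 t0.
have -> : s - t + (t ^+ 2 - s ^+ 2) / (2 * s) = (t - s) ^+ 2 / (2 * s).
  by field; rewrite gt_eqF.
have s2 : 0 < 2 * s by lra.
rewrite -(ler_pM2r s2) [leRHS]mulrDl divfK ?gt_eqF //.
have -> : t ^+ 2 - s ^+ 2 = (t - s) * (t + s) by ring.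
rewrite normrM (ger0_norm (_ : 0 <= t + s)) ?addr_ge0 ?(ltW s0) //.
rewrite -[(t - s) ^+ 2]real_normK ?num_real //.
move: (`|t - s|) => u.
have := sqr_ge0 (u - lam * s * (t + s)).
have := sqr_ge0 (lam * s * (t - s)).
nra.
Qed.

(** The sum of the concavity gaps of [sqrt_gap] is the loss of energy, since the
    linear terms cancel on every fibre of [l]. For a bounded total mass, a
    suitable [lam] turns this into both directions that are needed: a refinement
    that moves the means must lose energy, and one that loses little energy
    moves them little. *)
Lemma energy_drop (T T' : finType) (l : Omega -> T) (l' : Omega -> T')
    (h : T' -> T) a (L lam : R) :
  (forall w, l w = h (l' w)) -> (forall w, 0 <= a w) -> 0 <= lam ->
  lam * (\sum_(w | fibre_mean l a w <= L)
            `|fibre_mean l' a w - fibre_mean l a w|) <=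
  energy l a - energy l' a + 2 * lam ^+ 2 * Num.sqrt L * \sum_w a w.
Proof.
move=> lh a0 lam0.
set a1 := fibre_mean l' a; set a2 := fibre_mean l a.
have a10 w : 0 <= a1 w by exact: fibre_mean_ge0.
have a20 w : 0 <= a2 w by exact: fibre_mean_ge0.
have sum1 : \sum_w a1 w = \sum_w a w.
  transitivity (\sum_w 1 * a1 w); first by apply: eq_bigr => w _; rewrite mul1r.
  by rewrite sum_fibre_mean //; apply: eq_bigr => w _; rewrite mul1r.
have sum2 : \sum_w a2 w = \sum_w a w.
  transitivity (\sum_w 1 * a2 w); first by apply: eq_bigr => w _; rewrite mul1r.
  by rewrite sum_fibre_mean //; apply: eq_bigr => w _; rewrite mul1r.
pose g w := (2 * Num.sqrt (a2 w))^-1.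
pose gap w := Num.sqrt (a2 w) - Num.sqrt (a1 w) + (a1 w - a2 w) * g w.
have gapE : \sum_w gap w = energy l a - energy l' a.
  rewrite /gap big_split /= sumrB.
  have -> : \sum_w (a1 w - a2 w) * g w = 0; last by rewrite addr0.
  transitivity (\sum_w g w * a1 w - \sum_w g w * a2 w).
    by rewrite -sumrB; apply: eq_bigr => w _; rewrite -mulrBr mulrC.
  have gl v w : l v = l w -> g v = g w.
    by move=> e; rewrite /g /a2 (fibre_mean_fibre _ e).
  (* The weight g is constant on the fibres of l, hence also of l', so that both
   sums equal the sum of g times a. *)
  rewrite !sum_fibre_mean ?subrr // => v w e.
  by apply: gl; rewrite !lh e.
have gap_loc w : lam * `|a1 w - a2 w| <=
    gap w + lam ^+ 2 * Num.sqrt (a2 w) * (a1 w + a2 w).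
  have [z|nz] := eqVneq (a2 w) 0.
    have z1 : a1 w = 0.
      rewrite /a1 /fibre_mean big1 ?mul0r // => v /eqP e.
      by apply: (fibre_mean_eq0 a0 z); rewrite !lh e.
    by rewrite /gap z z1 !subrr normr0 sqrtr0 !(mulr0, mul0r, addr0).
  have s0 : 0 < Num.sqrt (a2 w) by rewrite sqrtr_gt0 lt_neqAle eq_sym nz a20.
  have := sqrt_gap lam s0 (sqrtr_ge0 (a1 w)).
  by rewrite !sqr_sqrtr.
have gap0 w : 0 <= gap w.
  have [z|nz] := eqVneq (a2 w) 0.
    have z1 : a1 w = 0.
      rewrite /a1 /fibre_mean big1 ?mul0r // => v /eqP e.
      by apply: (fibre_mean_eq0 a0 z); rewrite !lh e.
    by rewrite /gap z z1 !subrr mul0r addr0.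
  have s0 : 0 < Num.sqrt (a2 w) by rewrite sqrtr_gt0 lt_neqAle eq_sym nz a20.
  have := sqrt_gap 0 s0 (sqrtr_ge0 (a1 w)).
  by rewrite !sqr_sqrtr // expr0n /= !mul0r addr0.
rewrite -gapE mulr_sumr.
apply: le_trans (_ : \sum_(w | a2 w <= L)
   (gap w + lam ^+ 2 * Num.sqrt L * (a1 w + a2 w)) <= _).
  apply: ler_sum => w wL; apply: le_trans (gap_loc w) _.
  rewrite lerD2l ler_wpM2r ?addr_ge0 // ler_wpM2l ?sqr_ge0 //.
  by rewrite ler_wsqrtr.
rewrite big_mkcond /=.
apply: le_trans (_ : \sum_w
   (gap w + lam ^+ 2 * Num.sqrt L * (a1 w + a2 w)) <= _).
  apply: ler_sum => w _; case: ifP => // _.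
  by rewrite addr_ge0 // !mulr_ge0 ?sqrtr_ge0 ?addr_ge0 ?sqr_ge0.
rewrite big_split /= lerD2l -mulr_sumr big_split /= sum1 sum2.
by rewrite le_eqVlt; apply/orP; left; apply/eqP; ring.
Qed.

End Energy.

(** * Regular partitions of a kernel *)

Definition cut_le (R : realFieldType) (V : finType) (c : R) (D : V -> V -> R) :
    Prop :=
  forall X Y : {set V}, `|\sum_(x in X) \sum_(y in Y) D x y| <= c.

Section BlockMean.
Variables (R : rcfType) (V : finType).
Implicit Types (a : V -> V -> R).

Definition block_mean (T : finType) (p : V -> T) a (x y : V) : R :=
  fibre_mean (fun w : V * V => (p w.1, p w.2)) (fun w => a w.1 w.2) (x, y).

Definition block_energy (T : finType) (p : V -> T) a : R :=
  energy (fun w : V * V => (p w.1, p w.2)) (fun w => a w.1 w.2).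

(** The discrepancy is cut off on the blocks of large mean: energy gives no
    control there. *)
Definition deviation (L : R) (T : finType) (p : V -> T) a (x y : V) : R :=
  if block_mean p a x y <= L then a x y - block_mean p a x y else 0.

Lemma block_mean_ge0 (T : finType) (p : V -> T) a x y :
  (forall x y, 0 <= a x y) -> 0 <= block_mean p a x y.
Proof. by move=> a0; apply: fibre_mean_ge0. Qed.

Lemma block_mean_block (T : finType) (p : V -> T) a x y x' y' :
  p x = p x' -> p y = p y' -> block_mean p a x y = block_mean p a x' y'.
Proof. by move=> ex ey; apply: fibre_mean_fibre; rewrite /= ex ey. Qed.

Lemma sum_block_mean (T : finType) (p : V -> T) a (g : V * V -> R) :
  (forall x y x' y', p x = p x' -> p y = p y' -> g (x, y) = g (x', y')) ->
  \sum_w g w * block_mean p a w.1 w.2 = \sum_w g w * a w.1 w.2.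
Proof.
move=> gp.
rewrite -(@sum_fibre_mean _ _ _ (fun w => (p w.1, p w.2))
            (fun w => a w.1 w.2)); last by move=> [x y] [x' y'] [] /gp; apply.
by apply: eq_bigr => -[x y].
Qed.

Lemma block_energy_drop (T T' : finType) (p : V -> T) (p' : V -> T')
    (h : T' -> T) a (L lam : R) :
  (forall x, p x = h (p' x)) -> (forall x y, 0 <= a x y) -> 0 <= lam ->
  lam * (\sum_(w : V * V | block_mean p a w.1 w.2 <= L)
            `|block_mean p' a w.1 w.2 - block_mean p a w.1 w.2|) <=
  block_energy p a - block_energy p' a +
  2 * lam ^+ 2 * Num.sqrt L * \sum_(w : V * V) a w.1 w.2.
Proof.
move=> ph a0 lam0.
have lh (w : V * V) : (p w.1, p w.2) = (h (p' w.1), h (p' w.2)) by rewrite !ph.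
apply: le_trans (@energy_drop _ _ _ _ _ (fun w => (p' w.1, p' w.2))
  (fun t => (h t.1, h t.2)) (fun w => a w.1 w.2) L lam lh _ lam0); last by [].
by apply: ler_wpM2l.
Qed.

(** The coarsest refinement of [p] for which [X] and [Y] are unions of parts. *)
Definition split_label (T : finType) (p : V -> T) (X Y : {set V}) (x : V) :
  T * bool * bool := (p x, x \in X, x \in Y).

(** On the blocks of the refined label the kernel may be replaced by its block
    means, because [X] and [Y] are unions of its parts. *)
Lemma deviation_le_split (L : R) (T : finType) (p : V -> T) a (X Y : {set V}) :
  `|\sum_(x in X) \sum_(y in Y) deviation L p a x y| <=
  \sum_(w : V * V | block_mean p a w.1 w.2 <= L)
     `|block_mean (split_label p X Y) a w.1 w.2 - block_mean p a w.1 w.2|.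
Proof.
set p' := split_label p X Y.
pose g (w : V * V) : R :=
  ((w.1 \in X) && (w.2 \in Y) && (block_mean p a w.1 w.2 <= L))%:R.
have -> : \sum_(x in X) \sum_(y in Y) deviation L p a x y =
    \sum_w g w * (block_mean p' a w.1 w.2 - block_mean p a w.1 w.2).
  transitivity (\sum_w g w * (a w.1 w.2 - block_mean p a w.1 w.2)).
    rewrite pair_big /= big_mkcond /=; apply: eq_bigr => -[x y] _ /=.
    rewrite /g /deviation /=; case: (x \in X) => /=; last by rewrite mul0r.
    case: (y \in Y) => /=; last by rewrite mul0r.
    by case: ifP; rewrite ?mul1r ?mul0r.
  have dist b : \sum_w g w * (b w - block_mean p a w.1 w.2) =
      \sum_w g w * b w - \sum_w g w * block_mean p a w.1 w.2.
    by rewrite -sumrB; apply: eq_bigr => w _; rewrite mulrBr.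
  rewrite !dist; congr (_ - _); symmetry.
  apply: sum_block_mean => x y x' y' [px xX xY] [py yX yY].
  by rewrite /g /= xX yY (block_mean_block _ px py).
apply: le_trans (ler_norm_sum _ _ _) _.
rewrite [leRHS]big_mkcond /=; apply: ler_sum => w _.
rewrite normrM /g; case: (block_mean p a w.1 w.2 <= L).
  by case: (_ && _) => /=; rewrite ?normr1 ?normr0 ?mul1r ?mul0r.
by rewrite andbF normr0 mul0r.
Qed.

End BlockMean.

Section Regularity.
Variable R : realType.

(** As long as a pair [X], [Y] witnesses a large cut norm, splitting the parts
    along it loses a fixed amount of energy. The number of splittings depends
    only on the mean bound, the cut-off and the precision; each multiplies the
    number of parts by 4. *)
Lemma weak_regularity (c L psi : R) : 0 < c -> 0 < L -> 0 < psi ->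
  exists s : nat, forall (V T : finType) (p : V -> T) (a : V -> V -> R),
    (forall x y, 0 <= a x y) ->
    \sum_(w : V * V) a w.1 w.2 <= c * (#|V|)%:R ^+ 2 ->
  exists (T' : finType) (p' : V -> T') (h : T' -> T),
    [/\ forall x, p x = h (p' x), (#|T'| <= 4 ^ s * #|T|)%N
      & cut_le (psi * (#|V|)%:R ^+ 2) (deviation L p' a)].
Proof.
move=> c0 L0 psi0.
have sL0 : 0 < Num.sqrt L by rewrite sqrtr_gt0.
pose lam := psi / (4 * Num.sqrt L * c).
have lam0 : 0 < lam by rewrite divr_gt0 // !mulr_gt0.
pose g := lam * psi / 2.
have g0 : 0 < g by rewrite divr_gt0 ?(mulr_gt0 lam0 psi0).
have gE : lam * psi - 2 * lam ^+ 2 * Num.sqrt L * c = g.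
  by rewrite /g /lam; field; rewrite !gt_eqF.
clearbody g lam.
exists (Num.bound ((1 + c) / g)) => V T p a a0 ac.
set n2 : R := (#|V|)%:R ^+ 2 in ac *.
have n20 : 0 <= n2 by rewrite exprn_ge0.
have drop (T0 : finType) (p0 : V -> T0) (X Y : {set V}) :
    psi * n2 < `|\sum_(x in X) \sum_(y in Y) deviation L p0 a x y| ->
    block_energy (split_label p0 X Y) a < block_energy p0 a - g * n2.
  move=> /lt_le_trans /(_ (deviation_le_split L p0 a X Y)).
  rewrite -(ltr_pM2l lam0) => h1.
  have h2 := @block_energy_drop _ _ _ _ p0 (split_label p0 X Y)
               (fun t => t.1.1) a L lam (fun=> erefl) a0 (ltW lam0).
  have h3 : 2 * lam ^+ 2 * Num.sqrt L * \sum_(w : V * V) a w.1 w.2 <=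
         2 * lam ^+ 2 * Num.sqrt L * (c * n2).
    by apply: ler_wpM2l ac; rewrite !mulr_ge0 // ltW.
  by rewrite -gE mulrBl; move: h1 h2 h3; lra.
have : block_energy p a <= (Num.bound ((1 + c) / g))%:R * g * n2.
  apply: le_trans (energy_le _ _) _; first by [].
  rewrite card_prod natrM -expr2 -/n2.
  apply: le_trans (_ : (1 + c) * n2 <= _).
    by rewrite mulrDl mul1r lerD2l.
  rewrite ler_wpM2r // -ler_pdivrMr // ltW // archi_boundP //.
  by rewrite divr_ge0 ?(ltW g0) // addr_ge0 ?(ltW c0).
elim: (Num.bound _) T p => [|s IH] T p pen;
  case: (boolP `[< cut_le (psi * n2) (deviation L p a) >]) => [/asboolP reg|].
- by exists T, p, id; split=> //; rewrite expn0 mul1n.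
- move=> /asboolPn /existsNP [X /existsNP [Y /negP]]; rewrite -ltNge => /drop.
  have := energy_ge0 (fun w : V * V => (split_label p X Y w.1, split_label p X Y w.2))
            (fun w => a w.1 w.2).
  rewrite -/(block_energy (split_label p X Y) a).
  have : 0 <= g * n2 by rewrite mulr_ge0 // ltW.
  by move: pen; rewrite !mul0r; lra.
- by exists T, p, id; split=> //; rewrite leq_pmull // expn_gt0.
- move=> /asboolPn /existsNP [X /existsNP [Y /negP]]; rewrite -ltNge => /drop dr.
  have [|T' [q [h [qh qc qr]]]] := IH _ (split_label p X Y).
    by move: pen dr; rewrite -natr1 mulrDl mulrDl mul1r; lra.
  exists T', q, (fun t => (h t).1.1); split=> // [x|].
    by rewrite -qh.
  apply: leq_trans qc _; rewrite !card_prod card_bool expnS.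
  by lia.
Qed.

(** Iterate [weak_regularity], the precision at each stage being chosen from the
    number of parts already present, and stop at the first stage that loses
    little energy. Then [p'] describes the graph to a precision that may be
    arbitrarily small in terms of the number of parts of [p], although its block
    means are nearly those of [p]. *)
Lemma strong_regularity (c L L' kap : R) (psi : nat -> R) :
  0 < c -> 0 < L -> 0 < L' -> 0 < kap -> (forall m, 0 < psi m) ->
  exists M : nat, forall (V : finType) (a : V -> V -> R),
    (forall x y, 0 <= a x y) ->
    \sum_(w : V * V) a w.1 w.2 <= c * (#|V|)%:R ^+ 2 ->
  exists (m : nat) (T T' : finType) (p : V -> T) (p' : V -> T') (h : T' -> T),
    [/\ (m <= M)%N, (#|T| <= m)%N, forall x, p x = h (p' x),
        \sum_(w : V * V | block_mean p a w.1 w.2 <= L)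
           `|block_mean p' a w.1 w.2 - block_mean p a w.1 w.2| <=
           kap * (#|V|)%:R ^+ 2
      & cut_le (psi m * (#|V|)%:R ^+ 2) (deviation L' p' a)].
Proof.
move=> c0 L0 L'0 kap0 psi0.
have sL0 : 0 < Num.sqrt L by rewrite sqrtr_gt0.
pose lam := kap / (4 * Num.sqrt L * c).
have lam0 : 0 < lam by rewrite divr_gt0 // !mulr_gt0.
pose g := lam * kap / 2.
have g0 : 0 < g by rewrite divr_gt0 ?(mulr_gt0 lam0 kap0).
have gE : lam * kap - 2 * lam ^+ 2 * Num.sqrt L * c = g.
  by rewrite /g /lam; field; rewrite !gt_eqF.
clearbody g lam.
suff main (N : nat) : forall m0 : nat, exists M : nat,
  forall (V T : finType) (p : V -> T) (a : V -> V -> R),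
    (forall x y, 0 <= a x y) ->
    \sum_(w : V * V) a w.1 w.2 <= c * (#|V|)%:R ^+ 2 ->
    (#|T| <= m0)%N ->
    block_energy p a <= N%:R * g * (#|V|)%:R ^+ 2 ->
  exists (m : nat) (T1 T2 : finType) (p1 : V -> T1) (p2 : V -> T2)
      (h : T2 -> T1),
    [/\ (m <= M)%N, (#|T1| <= m)%N, forall x, p1 x = h (p2 x),
        \sum_(w : V * V | block_mean p1 a w.1 w.2 <= L)
           `|block_mean p2 a w.1 w.2 - block_mean p1 a w.1 w.2| <=
           kap * (#|V|)%:R ^+ 2
      & cut_le (psi m * (#|V|)%:R ^+ 2) (deviation L' p2 a)].
  have [M HM] := main (Num.bound ((1 + c) / g)) 1%N.
  exists M => V a a0 ac.
  apply: (HM V unit (fun=> tt) a) => //; first by rewrite card_unit.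
  apply: le_trans (energy_le _ _) _; first by [].
  rewrite card_prod natrM -expr2.
  apply: le_trans (_ : (1 + c) * (#|V|)%:R ^+ 2 <= _).
    by rewrite mulrDl mul1r lerD2l.
  rewrite ler_wpM2r ?exprn_ge0 // -ler_pdivrMr // ltW // archi_boundP //.
  by rewrite divr_ge0 ?(ltW g0) // addr_ge0 ?(ltW c0).
(* The refinement q of p either loses little energy, and then (p, q) is the
   required pair, or loses at least g n^2, which happens at most N times. *)
have step (V T T' : finType) (p : V -> T) (q : V -> T') (h : T' -> T) a :
    (forall x y, 0 <= a x y) ->
    \sum_(w : V * V) a w.1 w.2 <= c * (#|V|)%:R ^+ 2 ->
    (forall x, p x = h (q x)) ->
    block_energy p a - block_energy q a <= g * (#|V|)%:R ^+ 2 ->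
    \sum_(w : V * V | block_mean p a w.1 w.2 <= L)
       `|block_mean q a w.1 w.2 - block_mean p a w.1 w.2| <=
       kap * (#|V|)%:R ^+ 2.
  move=> a0 ac pq small; rewrite -(ler_pM2l lam0).
  have h1 := block_energy_drop L pq a0 (ltW lam0).
  have h2 : 2 * lam ^+ 2 * Num.sqrt L * \sum_(w : V * V) a w.1 w.2 <=
      2 * lam ^+ 2 * Num.sqrt L * (c * (#|V|)%:R ^+ 2).
    by apply: ler_wpM2l ac; rewrite !mulr_ge0 // ltW.
  by move: small h1 h2; rewrite -gE mulrBl; lra.
elim: N => [|N IH] m0;
  have [s Hs] := @weak_regularity c L' (psi m0) c0 L'0 (psi0 m0).
  exists m0 => V T p a a0 ac Tm pen.
  have [T' [q [h [qh qc qr]]]] := Hs V T p a a0 ac.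
  exists m0, T, T', p, q, h; split=> //.
  apply: step qh _ => //.
  have : 0 <= block_energy q a by exact: energy_ge0.
  have : 0 <= g * (#|V|)%:R ^+ 2 by rewrite mulr_ge0 ?exprn_ge0 // ltW.
  by move: pen; rewrite !mul0r; lra.
have [M HM] := IH (4 ^ s * m0)%N.
exists (maxn m0 M) => V T p a a0 ac Tm pen.
have [T' [q [h [qh qc qr]]]] := Hs V T p a a0 ac.
have [small|big] := lerP (block_energy p a - block_energy q a)
                         (g * (#|V|)%:R ^+ 2).
  exists m0, T, T', p, q, h; split=> //; first exact: leq_maxl.
  exact: step qh small.
have [||m [T1 [T2 [p1 [p2 [h' [mM ? ? ? ?]]]]]]] := HM V T' q a a0 ac.
- by apply: leq_trans qc _; rewrite leq_mul2l Tm orbT.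
- by move: pen big; rewrite -natr1 mulrDl mulrDl mul1r; lra.
- by exists m, T1, T2, p1, p2, h'; split=> //; rewrite leq_max mM orbT.
Qed.

End Regularity.

(** * Transferring a triangle count in cut norm *)

Section Triple.
Variables (R : realFieldType) (V : finType).
Local Notation kernel := (V -> V -> R).
Local Notation n := ((#|V|)%:R : R).
Implicit Types (D F H K b w : kernel) (f g : V -> R) (c l : R).

(** The cut norm tested on functions instead of sets. *)
Definition weak_le c D : Prop := forall f g,
  (forall x, 0 <= f x <= 1) -> (forall x, 0 <= g x <= 1) ->
  `|\sum_x \sum_y f x * D x y * g y| <= c.

Lemma sum_le_pos f g : (forall x, 0 <= f x <= 1) ->
  \sum_x f x * g x <= \sum_(x in [set x | 0 < g x]) g x.
Proof.
move=> f01; rewrite [leRHS]big_mkcond /=; apply: ler_sum => x _.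
have /andP[f0 f1] := f01 x; rewrite inE; case: ltrP => [g0|]; last nra.
by rewrite -[leRHS]mul1r ler_wpM2r // ltW.
Qed.

(** A bilinear form on functions with values in [0, 1] is largest at indicator
    functions. *)
Lemma cut_weak_le c D : cut_le c D -> weak_le c D.
Proof.
move=> cutD.
suff half D' : cut_le c D' -> forall f g,
    (forall x, 0 <= f x <= 1) -> (forall x, 0 <= g x <= 1) ->
    \sum_x \sum_y f x * D' x y * g y <= c.
  move=> f g f01 g01; rewrite ler_norml half // andbT lerNl -sumrN.
  apply: le_trans (half (fun x y => - D x y) _ f g f01 g01).
    apply: ler_sum => x _; rewrite -sumrN; apply: ler_sum => y _.
    by rewrite mulrN mulNr.
  move=> X Y; rewrite -[X in X <= _]normrN -sumrN.
  rewrite (eq_bigr (fun x => \sum_(y in Y) D x y)) // => x _.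
  by rewrite -sumrN; apply: eq_bigr => y _; rewrite opprK.
move: D' => {cutD}D cutD f g f01 g01.
pose h y := \sum_x f x * D x y; pose Y := [set y | 0 < h y].
pose h' x := \sum_(y in Y) D x y; pose X := [set x | 0 < h' x].
apply: le_trans (cutD X Y); apply: le_trans (ler_norm _).
apply: le_trans (sum_le_pos h' f01).
have -> : \sum_x f x * h' x = \sum_(y in Y) h y.
  rewrite exchange_big /=; apply: eq_bigr => x _; exact: mulr_sumr.
apply: le_trans (sum_le_pos h g01).
rewrite exchange_big /= le_eqVlt; apply/orP; left; apply/eqP.
apply: eq_bigr => y _; rewrite mulr_sumr; apply: eq_bigr => x _.
by rewrite mulrC.
Qed.

Lemma weak_le_scale c D f g (a e : R) : weak_le c D -> 0 <= a -> 0 <= e ->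
  (forall x, 0 <= f x <= a) -> (forall x, 0 <= g x <= e) ->
  `|\sum_x \sum_y f x * D x y * g y| <= c * a * e.
Proof.
move=> wD; rewrite le_eqVlt => /orP [/eqP<- _ f0 _|a0].
  rewrite big1 ?normr0 ?mulr0 ?mul0r // => x _; rewrite big1 // => y _.
  by have /le_anti <- := f0 x; rewrite !mul0r.
rewrite le_eqVlt => /orP [/eqP<- _ g0|e0 fa ge].
  rewrite big1 ?normr0 ?mulr0 // => x _; rewrite big1 // => y _.
  by have /le_anti <- := g0 y; rewrite mulr0.
have := wD (fun x => f x / a) (fun y => g y / e).
have -> : \sum_x \sum_y f x / a * D x y * (g y / e) =
    (\sum_x \sum_y f x * D x y * g y) / (a * e).
  rewrite mulr_suml; apply: eq_bigr => x _; rewrite mulr_suml.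
  by apply: eq_bigr => y _; field; rewrite !gt_eqF.
rewrite normrM normfV (ger0_norm (_ : 0 <= a * e)) ?mulr_ge0 ?(ltW a0) ?(ltW e0) //.
rewrite ler_pdivrMr ?mulr_gt0 // mulrA; apply.
  move=> x; have /andP[f0 f1] := fa x.
  by rewrite divr_ge0 ?(ltW a0) // ler_pdivrMr // mul1r.
move=> x; have /andP[f0 f1] := ge x.
by rewrite divr_ge0 ?(ltW e0) // ler_pdivrMr // mul1r.
Qed.

Lemma sum_cst (r : R) : \sum_(x : V) r = n * r.
Proof. by rewrite sumr_const mulr_natl. Qed.

(** In the application [F] and [H] count walks with k steps and [b] is the
    remaining edge of a closed walk with 2k + 1 steps. *)
Definition triple F b H : R := \sum_x \sum_y \sum_z F x y * b y z * H z x.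

Lemma triple_rot F b H : triple F b H = triple b H F.
Proof.
rewrite /triple exchange_big /=; apply: eq_bigr => y _.
rewrite exchange_big /=; apply: eq_bigr => z _; apply: eq_bigr => x _.
by rewrite -mulrA mulrC.
Qed.

(** For fixed x the functions F x and H^~ x are bounded test functions for the
    middle kernel. *)
Lemma triple_slice c F H b w (f h : R) :
  weak_le c (fun x y => b x y - w x y) -> 0 <= f -> 0 <= h ->
  (forall x y, 0 <= F x y <= f) -> (forall x y, 0 <= H x y <= h) ->
  triple F w H - n * (c * f * h) <= triple F b H.
Proof.
move=> wD f0 h0 Ff Hh; rewrite -sum_cst -sumrB; apply: ler_sum => x _.
have := weak_le_scale wD f0 h0 (Ff x) (fun z => Hh z x).
have -> : \sum_y \sum_z F x y * (b y z - w y z) * H z x =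
    \sum_y \sum_z F x y * b y z * H z x - \sum_y \sum_z F x y * w y z * H z x.
  rewrite -sumrB; apply: eq_bigr => y _; rewrite -sumrB.
  by apply: eq_bigr => z _; rewrite mulrBr mulrBl.
by rewrite ler_norml => /andP[+ _]; lra.
Qed.

(** Truncation at [l] discards at most H^2 / l, which the second moment of [H]
    controls. *)
Lemma triple_trunc F H w (f L S l : R) : 0 < l -> 0 <= f -> 0 <= L ->
  (forall x y, 0 <= F x y <= f) -> (forall x y, 0 <= w x y <= L) ->
  (forall x y, 0 <= H x y) -> \sum_x \sum_y H x y ^+ 2 <= S ->
  triple F w H - n * (f * L * S / l) <=
  triple F w (fun x y => Num.min (H x y) l).
Proof.
move=> l0 f0 L0 Ff wL H0 HS.
have tail x y : H x y - Num.min (H x y) l <= H x y ^+ 2 / l.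
  have h0 := H0 x y; have [hl|hl] := lerP (H x y) l.
    by rewrite subrr divr_ge0 ?exprn_ge0 // ltW.
  rewrite ler_pdivlMr //; nra.
have tail0 x y : 0 <= H x y - Num.min (H x y) l.
  by rewrite subr_ge0 ge_min lexx.
rewrite lerBlDr -lerBlDl.
apply: le_trans (_ : \sum_x \sum_(y : V) \sum_z f * L * (H z x ^+ 2 / l) <= _).
  rewrite /triple -sumrB; apply: ler_sum => x _.
  rewrite -sumrB; apply: ler_sum => y _; rewrite -sumrB; apply: ler_sum => z _.
  rewrite -mulrBr; have /andP[F0 Fle] := Ff x y; have /andP[w0 wle] := wL y z.
  by rewrite ler_pM ?mulr_ge0 // ler_pM.
have -> : \sum_x \sum_(y : V) \sum_z f * L * (H z x ^+ 2 / l) =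
    n * (f * L * (\sum_z \sum_x H z x ^+ 2) / l).
  rewrite -sum_cst exchange_big; apply: eq_bigr => y _ /=.
  rewrite mulr_sumr mulr_suml exchange_big; apply: eq_bigr => z _ /=.
  rewrite mulr_sumr mulr_suml; apply: eq_bigr => x _.
  by rewrite mulrA.
rewrite ler_wpM2l ?ler0n // ler_wpM2r ?invr_ge0 ?(ltW l0) //.
by rewrite ler_wpM2l ?mulr_ge0.
Qed.

(** Only a second moment bound is available for [F] and [H], so they are first
    truncated, at [l1] and [l2]; this can only lower the left factor. Then the
    middle kernel is replaced by [w], the truncation of [H] undone and [H]
    replaced by [HW], and lastly the same for [F]. Undoing the truncation of [H]
    costs l1 / l2, which forces [l2] to be much larger than [l1], whereas the
    truncation of [F] is undone when both other factors are already bounded. *)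
Lemma triple_transfer F H b w FW HW (C L B l1 l2 c c1 : R) :
  0 <= L -> 0 <= B -> 0 < l1 -> 0 < l2 ->
  (forall x y, 0 <= F x y) -> (forall x y, 0 <= H x y) ->
  (forall x y, 0 <= b x y) -> (forall x y, 0 <= w x y <= L) ->
  (forall x y, 0 <= HW x y <= B) ->
  \sum_x \sum_y F x y ^+ 2 <= C * n ^+ 2 ->
  \sum_x \sum_y H x y ^+ 2 <= C * n ^+ 2 ->
  weak_le (c * n ^+ 2) (fun x y => b x y - w x y) ->
  weak_le (c1 * n ^+ 2) (fun x y => F x y - FW x y) ->
  weak_le (c1 * n ^+ 2) (fun x y => H x y - HW x y) ->
  triple FW w HW -
    n ^+ 3 * (c * l1 * l2 + l1 * L * C / l2 + c1 * l1 * L +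
              B * L * C / l1 + c1 * L * B) <= triple F b H.
Proof.
move=> L0 B0 l10 l20 F0 H0 b0 wL HWB F2 H2 bw FFW HHW.
pose F' x y := Num.min (F x y) l1; pose H' x y := Num.min (H x y) l2.
have minb (l : R) K x y : 0 < l -> (forall x y, 0 <= K x y) ->
    0 <= Num.min (K x y) l <= l.
  by move=> l0 K0; rewrite ge_min lexx orbT andbT le_min K0 ltW.
have F'l x y : 0 <= F' x y <= l1 by exact: minb.
have H'l x y : 0 <= H' x y <= l2 by exact: minb.
have s1 : triple F' b H' <= triple F b H.
  rewrite /triple; apply: ler_sum => x _; apply: ler_sum => y _.
  apply: ler_sum => z _; have /andP[f0 _] := F'l x y.
  have /andP[h0 _] := H'l z x.
  by rewrite !ler_pM ?mulr_ge0 // /F' /H' ge_min lexx.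
have s2 := triple_slice bw (ltW l10) (ltW l20) F'l H'l.
have s3 := triple_trunc l20 (ltW l10) L0 F'l wL H0 H2.
have s4 := triple_slice HHW L0 (ltW l10) wL F'l.
have s5 := triple_trunc l10 L0 B0 wL HWB F0 F2.
have s6 := triple_slice FFW B0 L0 HWB wL.
rewrite -!(triple_rot F') -/F' in s4.
rewrite -(triple_rot F) -/F' -(triple_rot F') in s5.
rewrite (triple_rot HW F) (triple_rot HW FW) in s6.
have e1 : n * (c * n ^+ 2 * l1 * l2) = n ^+ 3 * (c * l1 * l2) by ring.
have e2 : n * (l1 * L * (C * n ^+ 2) / l2) = n ^+ 3 * (l1 * L * C / l2) by ring.
have e3 : n * (c1 * n ^+ 2 * L * l1) = n ^+ 3 * (c1 * l1 * L) by ring.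
have e4 : n * (L * B * (C * n ^+ 2) / l1) = n ^+ 3 * (B * L * C / l1) by ring.
have e5 : n * (c1 * n ^+ 2 * B * L) = n ^+ 3 * (c1 * L * B) by ring.
move: s1 s2 s3 s4 s5 s6; rewrite e1 e2 e3 e4 e5 /H' !mulrDr.
lra.
Qed.

End Triple.

(** * Chains of kernels *)

Section Chain.
Variables (R : realFieldType) (V : finType).
Local Notation kernel := (V -> V -> R).
Local Notation n := ((#|V|)%:R : R).
Implicit Types (K b w : nat -> kernel).

(** Each composition is averaged over the middle vertex, so that chains of bounded
    kernels stay bounded; the identity for this product is n times the Kronecker
    delta. *)
Fixpoint chain K (j : nat) (x y : V) : R :=
  if j is i.+1 then n^-1 * \sum_z chain K i x z * K i z y
  else n * (x == y)%:R.

Definition closed_chain K r : R := \sum_x chain K r x x.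

Definition shift K i : nat -> kernel := fun j => K (i + j)%N.

Hypothesis n_gt0 : (0 < #|V|)%N.

Let n0 : 0 < n. Proof. by rewrite ltr0n. Qed.

Lemma sum_delta (f : V -> R) x : \sum_z (x == z)%:R * f z = f x.
Proof.
rewrite (bigD1 x) //= eqxx mul1r big1 ?addr0 // => z /negbTE.
by rewrite eq_sym => ->; rewrite mul0r.
Qed.

Lemma chain1 K x y : chain K 1 x y = K 0%N x y.
Proof.
rewrite /= -[RHS](sum_delta (fun z => K 0%N z y)) mulr_sumr.
by apply: eq_bigr => z _; rewrite -mulrA mulKf // gt_eqF.
Qed.

Lemma chain_cat K i j x y :
  chain K (i + j) x y = n^-1 * \sum_z chain K i x z * chain (shift K i) j z y.
Proof.
elim: j y => [|j IH] y.
  rewrite addn0 /= (bigD1 y) //= eqxx big1 => [|z /negbTE ->].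
    by rewrite mulr1 addr0 mulrC mulfK ?gt_eqF.
  by rewrite !mulr0.
rewrite addnS /=; congr (_ * _).
under eq_bigr do rewrite IH -mulrA mulr_suml mulr_sumr.
rewrite exchange_big /=; apply: eq_bigr => z _.
rewrite [RHS]mulrCA !mulr_sumr; apply: eq_bigr => u _.
by rewrite -[in LHS]mulrA.
Qed.

Lemma chain_ge0 K j x y : (forall i x y, 0 <= K i x y) -> 0 <= chain K j x y.
Proof.
move=> K0; elim: j y => [|j IH] y /=; first by rewrite mulr_ge0 ?ler0n.
by rewrite mulr_ge0 ?invr_ge0 ?(ltW n0) ?sumr_ge0 // => z _; rewrite mulr_ge0.
Qed.

Lemma chain_mono K b j x y :
  (forall i x y, 0 <= b i x y <= K i x y) -> chain b j x y <= chain K j x y.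
Proof.
move=> bK; have b0 i u v : 0 <= b i u v by have /andP[] := bK i u v.
elim: j y => [|j IH] y //=.
rewrite ler_wpM2l ?invr_ge0 ?(ltW n0) //; apply: ler_sum => z _.
by have /andP[_ le] := bK j z y; rewrite ler_pM // chain_ge0.
Qed.

Lemma chain_le_expr K (L : R) j x y : 0 <= L ->
  (forall i x y, 0 <= K i x y <= L) -> chain K j.+1 x y <= L ^+ j.+1.
Proof.
move=> L0 KL; have K0 i u v : 0 <= K i u v by have /andP[] := KL i u v.
elim: j y => [|j IH] y.
  by rewrite chain1 expr1; have /andP[] := KL 0%N x y.
have -> : chain K j.+2 x y = n^-1 * \sum_z chain K j.+1 x z * K j.+1 z y by [].
rewrite ler_pdivrMl // -sum_cst; apply: ler_sum => z _.
rewrite [leRHS]exprSr; have /andP[_ KLz] := KL j.+1 z y.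
by rewrite ler_pM // chain_ge0.
Qed.

Lemma chain_column K (M : R) j (f : V -> R) y : 0 <= M ->
  (forall i x y, 0 <= K i x y) -> (forall i y, \sum_x K i x y <= M * n) ->
  (forall x, 0 <= f x <= 1) ->
  \sum_x f x * chain K j x y <= M ^+ j * n.
Proof.
move=> M0 K0 KM f01; elim: j y => [|j IH] y.
  rewrite expr0 mul1r (bigD1 y) //= eqxx mulr1 big1 => [|x /negbTE ->].
    by rewrite addr0 ler_piMl ?ler0n //; have /andP[] := f01 y.
  by rewrite !mulr0.
have -> : \sum_x f x * chain K j.+1 x y =
    n^-1 * \sum_z (\sum_x f x * chain K j x z) * K j z y.
  rewrite /= [in RHS](eq_bigr _ (fun z _ => mulr_suml _ _ _ _)).
  rewrite exchange_big mulr_sumr; apply: eq_bigr => x _ /=.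
  rewrite mulrCA mulr_sumr; congr (_ * _); apply: eq_bigr => z _.
  by rewrite mulrA.
rewrite ler_pdivrMl //.
apply: le_trans (_ : \sum_z (M ^+ j * n) * K j z y <= _).
  by apply: ler_sum => z _; rewrite ler_wpM2r.
rewrite -mulr_sumr; apply: le_trans (ler_wpM2l _ (KM j y)) _.
  by rewrite mulr_ge0 ?exprn_ge0 // ltW.
by rewrite exprSr le_eqVlt; apply/orP; left; apply/eqP; ring.
Qed.

(** Replace the kernels one at a time. What precedes the replaced step is bounded
    through the column sums of [b], what follows it through the row sums of [w]. *)
Lemma chain_weak b w (M psi : R) j : 1 <= M -> 0 <= psi ->
  (forall i x y, 0 <= b i x y) -> (forall i y, \sum_x b i x y <= M * n) ->
  (forall i x y, 0 <= w i x y) -> (forall i x, \sum_y w i x y <= M * n) ->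
  (forall i, weak_le (psi * n ^+ 2) (fun x y => b i x y - w i x y)) ->
  weak_le (j%:R * psi * M ^+ j * n ^+ 2)
          (fun x y => chain b j x y - chain w j x y).
Proof.
move=> M1 psi0 b0 bM w0 wM bw.
have M0 : 0 <= M by apply: le_trans M1.
elim: j => [|j IH] f g f01 g01.
  rewrite big1 ?normr0 ?mul0r // => x _; rewrite big1 // => y _.
  by rewrite /= subrr mulr0 mul0r.
pose wg z := n^-1 * \sum_y w j z y * g y.
pose fb z := n^-1 * \sum_x f x * chain b j x z.
have -> : \sum_x \sum_y f x * (chain b j.+1 x y - chain w j.+1 x y) * g y =
    \sum_x \sum_z f x * (chain b j x z - chain w j x z) * wg z +
    \sum_z \sum_y fb z * (b j z y - w j z y) * g y.
  have -> : \sum_z \sum_y fb z * (b j z y - w j z y) * g y =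
      \sum_x \sum_z \sum_y
        n^-1 * f x * chain b j x z * (b j z y - w j z y) * g y.
    rewrite [RHS]exchange_big; apply: eq_bigr => z _ /=.
    rewrite [RHS]exchange_big; apply: eq_bigr => y _ /=.
    rewrite /fb mulr_sumr !mulr_suml; apply: eq_bigr => x _.
    by rewrite !mulrA.
  rewrite -big_split; apply: eq_bigr => x _ /=.
  rewrite -big_split /= (eq_bigr (fun y => \sum_z
    (n^-1 * f x * (chain b j x z * b j z y - chain w j x z * w j z y) * g y))).
    rewrite exchange_big; apply: eq_bigr => z _ /=.
    rewrite /wg !mulr_sumr -big_split; apply: eq_bigr => y _ /=.
    ring.
  move=> y _; rewrite -mulrBr -sumrB !mulr_sumr mulr_suml.
  by apply: eq_bigr => z _; rewrite !mulrA [f x * _]mulrC.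
have wg01 z : 0 <= wg z <= M.
  have g0 y : 0 <= g y by have /andP[] := g01 y.
  rewrite mulr_ge0 ?invr_ge0 ?(ltW n0) ?sumr_ge0 //=; last first.
    by move=> y _; rewrite mulr_ge0.
  rewrite ler_pdivrMl // mulrC; apply: le_trans (wM j z).
  by apply: ler_sum => y _; rewrite ler_piMr //; have /andP[] := g01 y.
have fb01 z : 0 <= fb z <= M ^+ j.
  rewrite mulr_ge0 ?invr_ge0 ?(ltW n0) ?sumr_ge0 //=; last first.
    move=> x _; have /andP[fx0 _] := f01 x.
    by rewrite mulr_ge0 // chain_ge0.
  by rewrite ler_pdivrMl // mulrC chain_column.
have g01' z : 0 <= g z <= 1 by [].
apply: le_trans (ler_normD _ _) _.
have h1 := weak_le_scale IH ler01 M0 f01 wg01.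
have h2 := weak_le_scale (bw j) (exprn_ge0 j M0) ler01 fb01 g01'.
apply: le_trans (lerD h1 h2) _; rewrite !mulr1.
have h3 : psi * n ^+ 2 * M ^+ j <= psi * n ^+ 2 * M ^+ j.+1.
  by rewrite ler_wpM2l ?mulr_ge0 ?exprn_ge0 ?(ltW n0) // ler_weXn2l.
have -> : j.+1%:R * psi * M ^+ j.+1 * n ^+ 2 =
    j%:R * psi * M ^+ j * n ^+ 2 * M + psi * n ^+ 2 * M ^+ j.+1.
  by rewrite -[j.+1%:R]natr1 exprSr; ring.
by rewrite lerD2l.
Qed.

End Chain.

(** * The counting lemma *)

Section Counting.
Variables (R : realFieldType).

(** The closed walk is cut after k steps and after k + 1 steps. *)
Lemma closed_chain_triple (V : finType) (K : nat -> V -> V -> R) k :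
  (0 < #|V|)%N ->
  closed_chain K (k.+1 + k) =
  (#|V|)%:R ^- 2 * triple (chain K k) (K k) (chain (shift K k.+1) k).
Proof.
move=> V0; rewrite /closed_chain /triple mulr_sumr; apply: eq_bigr => x _.
rewrite chain_cat // expr2 invfM -mulrA; congr (_ * _).
transitivity (\sum_z \sum_y #|V|%:R^-1 *
    (chain K k x y * K k y z * chain (shift K k.+1) k z x)).
  apply: eq_bigr => z _ /=; rewrite -mulrA mulr_suml mulr_sumr.
  by apply: eq_bigr.
rewrite exchange_big mulr_sumr; apply: eq_bigr => y _ /=.
by rewrite mulr_sumr.
Qed.

(** Cut-norm closeness to precision [psi] carries a density [rho] of closed
    (2k + 1)-chains over from a bounded model [w] to a kernel [b] that is only
    bounded in degree and in the second moment of its k-chains. *)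
Definition transfers (k : nat) (L M C rho psi : R) : Prop :=
  forall (V : finType) (b w : nat -> V -> V -> R), (0 < #|V|)%N ->
    (forall i x y, 0 <= b i x y) ->
    (forall i y, \sum_x b i x y <= M * (#|V|)%:R) ->
    (forall i x y, 0 <= w i x y <= L) ->
    (forall i, weak_le (psi * (#|V|)%:R ^+ 2)
                       (fun x y => b i x y - w i x y)) ->
    \sum_x \sum_y chain b k x y ^+ 2 <= C * (#|V|)%:R ^+ 2 ->
    \sum_x \sum_y chain (shift b k.+1) k x y ^+ 2 <= C * (#|V|)%:R ^+ 2 ->
    rho * (#|V|)%:R <= closed_chain w (k.+1 + k) ->
    rho / 2 * (#|V|)%:R <= closed_chain b (k.+1 + k).

(** The five error terms of [triple_transfer] become small when the parameters
    are chosen in the order [l1], [l2], [psi]. *)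
Lemma counting_lemma (k : nat) (L M C rho : R) :
  (0 < k)%N -> 0 < L -> L <= M -> 1 <= M -> 0 < C -> 0 < rho ->
  exists2 psi : R, 0 < psi & transfers k L M C rho psi.
Proof.
move=> k0 L0 LM M1 C0 rho0.
have [B BE] : exists B, B = L ^+ k by exists (L ^+ k).
have B0 : 0 < B by rewrite BE exprn_gt0.
(* The truncation levels make the two truncation errors equal to rho / 8; psi
   then makes the three cut-norm errors add up to rho / 4. *)
have [l1 l10 l1E] : exists2 l1, 0 < l1 & B * L * C / l1 = rho / 8.
  exists (8 * (B * L * C) / rho); first by rewrite divr_gt0 // !mulr_gt0.
  by field; rewrite !gt_eqF.
have [l2 l20 l2E] : exists2 l2, 0 < l2 & l1 * L * C / l2 = rho / 8.
  exists (8 * (l1 * L * C) / rho); first by rewrite divr_gt0 // !mulr_gt0.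
  by field; rewrite !gt_eqF.
have [c1 c1E] : exists c1, c1 = k%:R * M ^+ k by exists (k%:R * M ^+ k).
have c10 : 0 <= c1 by rewrite c1E mulr_ge0 ?exprn_ge0 // (le_trans _ M1).
have [S SE] : exists S, S = l1 * l2 + c1 * l1 * L + c1 * L * B.
  by exists (l1 * l2 + c1 * l1 * L + c1 * L * B).
have S0 : 0 < S.
  have : 0 < l1 * l2 by rewrite mulr_gt0.
  have : 0 <= c1 * l1 * L by rewrite !mulr_ge0 // ltW.
  have : 0 <= c1 * L * B by rewrite !mulr_ge0 // ltW.
  by rewrite SE; lra.
exists (rho / (4 * S)) => [|V b w V0 b0 bM wL bw Fb Hb main].
  by rewrite divr_gt0 // mulr_gt0.
set psi := rho / (4 * S) in bw.
have psi0 : 0 <= psi by rewrite divr_ge0 ?mulr_ge0 // ltW.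
have n0 : 0 < (#|V|)%:R :> R by rewrite ltr0n.
have w0 i x y : 0 <= w i x y by have /andP[] := wL i x y.
have wM i x : \sum_y w i x y <= M * (#|V|)%:R.
  rewrite mulrC -sum_cst; apply: ler_sum => y _; apply: le_trans LM.
  by have /andP[] := wL i x y.
have FFW := chain_weak V0 k M1 psi0 b0 bM w0 wM bw.
have HHW := @chain_weak _ _ V0 (shift b k.+1) (shift w k.+1) M psi k M1 psi0
  (fun i => b0 _) (fun i => bM _) (fun i => w0 _) (fun i => wM _) (fun i => bw _).
have cE : k%:R * psi * M ^+ k * (#|V|)%:R ^+ 2 = c1 * psi * (#|V|)%:R ^+ 2.
  by rewrite c1E; ring.
rewrite cE in FFW HHW.
have HWB x y : 0 <= chain (shift w k.+1) k x y <= B.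
  rewrite BE chain_ge0 //=; last by move=> i u v; apply: w0.
  by rewrite -(prednK k0); apply: chain_le_expr (ltW L0) _ => // i; apply: wL.
have := triple_transfer (ltW L0) (ltW B0) l10 l20
  (fun x y => chain_ge0 V0 k x y b0)
  (fun x y => chain_ge0 V0 k x y (fun i => b0 (k.+1 + i)%N))
  (b0 k) (wL k) HWB Fb Hb (bw k) FFW HHW.
move: main; rewrite !closed_chain_triple //.
set Tb := triple (chain b _) _ _; set Tw := triple (chain w _) _ _.
rewrite !ler_pdivlMl ?exprn_gt0 //.
have -> : psi * l1 * l2 + l1 * L * C / l2 + c1 * psi * l1 * L +
    B * L * C / l1 + c1 * psi * L * B = rho / 2.
  have -> : psi * l1 * l2 + l1 * L * C / l2 + c1 * psi * l1 * L +
    B * L * C / l1 + c1 * psi * L * B =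
    psi * S + l1 * L * C / l2 + B * L * C / l1 by rewrite SE; ring.
  have -> : psi * S = rho / 4 by rewrite /psi; field; rewrite gt_eqF.
  by rewrite l1E l2E; field.
have -> : #|V|%:R ^+ 2 * (rho * #|V|%:R) = rho * #|V|%:R ^+ 3 by ring.
have -> : #|V|%:R ^+ 2 * (rho / 2 * #|V|%:R) = #|V|%:R ^+ 3 * (rho / 2) by ring.
lra.
Qed.

(** Multiplies two lower bounds of the form main term minus error. The product of
    the two errors has the favourable sign, and where one of the bounds is
    negative the product of [X] and [Y] is bounded below by 0. *)
Lemma prod_defect_le (X Y al c A E I D : R) : 0 <= al -> 0 <= c ->
  0 <= X -> 0 <= Y -> 0 <= A -> 0 <= E -> 0 <= I -> 0 <= D ->
  al * (A - E) <= X -> c * (I - D) <= Y ->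
  al * c * (A * I - E * I - A * D) <= X * Y.
Proof.
move=> al0 c0 X0 Y0 A0 E0 I0 D0 AX IY.
have XY0 : 0 <= X * Y by rewrite mulr_ge0.
have ac0 : 0 <= al * c by rewrite mulr_ge0.
have [AE|AE] := lerP A E.
  apply: le_trans XY0; rewrite mulr_ge0_le0 //.
  have : A * I <= E * I by rewrite ler_wpM2r.
  have : 0 <= A * D by rewrite mulr_ge0.
  lra.
have [ID|ID] := lerP I D.
  apply: le_trans XY0; rewrite mulr_ge0_le0 //.
  have : A * I <= A * D by rewrite ler_wpM2l.
  have : 0 <= E * I by rewrite mulr_ge0.
  lra.
apply: le_trans (_ : al * (A - E) * (c * (I - D)) <= _); last first.
  by rewrite ler_pM // mulr_ge0 // subr_ge0 ltW.
have -> : al * (A - E) * (c * (I - D)) = al * c * ((A - E) * (I - D)) by ring.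
rewrite ler_wpM2l //.
have : 0 <= E * D by rewrite mulr_ge0.
lra.
Qed.

End Counting.

(** * Closed chains in the model *)

Section ModelCount.
Variables (R : realFieldType) (V : finType).
Variables (Vs : nat -> {set V}) (D w : nat -> V -> V -> R) (c kap : R).
Local Notation n := ((#|V|)%:R : R).
Local Notation ind i x := ((x \in Vs i)%:R : R).
Local Notation card i := ((#|Vs i|)%:R : R).
Hypothesis n_gt0 : (0 < #|V|)%N.
Hypothesis c_ge0 : 0 <= c.
Hypothesis w_ge0 : forall i x y, 0 <= w i x y.
Hypothesis D_ge0 : forall i x y, 0 <= D i x y.
Hypothesis D_sum : forall i,
  \sum_x \sum_y D i x y <= kap * (card i * card i.+1).
Hypothesis w_lower : forall i x y,
  c * (ind i x * ind i.+1 y - D i x y) <= w i x y.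

Lemma sum_ind i : \sum_x ind i x = card i.
Proof. by rewrite -sum1_card natr_sum [RHS]big_mkcond /=; apply: eq_bigr => x _; case: ifP. Qed.

Lemma ind_ge0 i x : 0 <= ind i x. Proof. by []. Qed.

Let inner (j : nat) : R := \prod_(i < j) card i.+1.

Lemma inner_ge0 j : 0 <= inner j.
Proof. by apply: prodr_ge0. Qed.

Lemma innerE j : \prod_(i < j.+2) card i = card 0%N * inner j * card j.+1.
Proof. by rewrite big_ord_recl -mulrA big_ord_recr. Qed.

(** A union bound over the defects [D] along the walk, carried out in the chain
    recursion. [E] collects the walks that meet a defect. *)
Lemma chain_lower j : exists E : V -> V -> R,
  [/\ forall x y, 0 <= E x y,
      \sum_x \sum_y E x y <= j.+1%:R * kap * \prod_(i < j.+2) card i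
    & forall x y, c ^+ j.+1 * n^-1 ^+ j *
        (ind 0%N x * inner j * ind j.+1 y - E x y) <= chain w j.+1 x y].
Proof.
have n0 : 0 < n by rewrite ltr0n.
elim: j => [|j [E [E0 Esum Ew]]].
  exists (D 0%N); split=> // [|x y].
    by rewrite innerE /inner big_ord0 mulr1 mul1r.
  by rewrite chain1 // expr1 expr0 mulr1 /inner big_ord0 mulr1.
pose E' x y := \sum_z (E x z * (ind j.+1 z * ind j.+2 y) +
                       ind 0%N x * inner j * ind j.+1 z * D j.+1 z y).
exists E'; split=> [x y|| x y].
- apply: sumr_ge0 => z _; rewrite addr_ge0 ?mulr_ge0 ?ind_ge0 ?inner_ge0 //.
- have -> : \sum_x \sum_y E' x y =
     (\sum_x \sum_z E x z * ind j.+1 z) * card j.+2 +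
     card 0%N * inner j * \sum_z \sum_y ind j.+1 z * D j.+1 z y.
    rewrite -(sum_ind 0) -(sum_ind j.+2) !mulr_suml -big_split.
    apply: eq_bigr => x _ /=.
    rewrite exchange_big mulr_suml mulr_sumr -big_split; apply: eq_bigr => z _ /=.
    rewrite !mulr_sumr -big_split; apply: eq_bigr => y _ /=.
    by ring.
  have h1 : \sum_x \sum_z E x z * ind j.+1 z <=
      j.+1%:R * kap * \prod_(i < j.+2) card i.
    apply: le_trans Esum; apply: ler_sum => x _; apply: ler_sum => z _.
    by case: (z \in _); rewrite ?mulr1 // mulr0.
  have h2 : \sum_z \sum_y ind j.+1 z * D j.+1 z y <= kap * (card j.+1 * card j.+2).
    apply: le_trans (D_sum _); apply: ler_sum => x _; apply: ler_sum => z _.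
    by case: (x \in _); rewrite ?mul1r // mul0r.
  rewrite [in leRHS]big_ord_recr /=.
  apply: le_trans (lerD (ler_wpM2r _ h1) (ler_wpM2l _ h2)) _ => //.
    by rewrite mulr_ge0 ?inner_ge0.
  rewrite innerE -[j.+2%:R]natr1 le_eqVlt; apply/orP; left; apply/eqP; ring.
have -> : chain w j.+2 x y = n^-1 * \sum_z chain w j.+1 x z * w j.+1 z y by [].
have -> : c ^+ j.+2 * n^-1 ^+ j.+1 * (ind 0 x * inner j.+1 * ind j.+2 y - E' x y) =
   n^-1 * \sum_z ((c ^+ j.+1 * n^-1 ^+ j) * c *
     ((ind 0%N x * inner j * ind j.+1 z) * (ind j.+1 z * ind j.+2 y)
      - E x z * (ind j.+1 z * ind j.+2 y)
      - (ind 0%N x * inner j * ind j.+1 z) * D j.+1 z y)).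
  rewrite -mulr_sumr.
  have -> : \sum_z (ind 0 x * inner j * ind j.+1 z * (ind j.+1 z * ind j.+2 y) -
       E x z * (ind j.+1 z * ind j.+2 y) - ind 0 x * inner j * ind j.+1 z * D j.+1 z y)
    = ind 0 x * inner j.+1 * ind j.+2 y - E' x y.
    rewrite /inner big_ord_recr /= -/(inner j) -(sum_ind j.+1).
    rewrite !mulr_sumr !mulr_suml /E' -sumrB; apply: eq_bigr => z _.
    by case: (z \in _) => /=; ring.
  by rewrite exprSr [n^-1 ^+ j.+1]exprS; ring.
rewrite ler_wpM2l ?invr_ge0 ?(ltW n0) //; apply: ler_sum => z _.
apply: prod_defect_le; rewrite ?chain_ge0 ?mulr_ge0 ?exprn_ge0 ?invr_ge0 ?ind_ge0 ?inner_ge0 //.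
Qed.

Lemma closed_chain_lower r : (1 < r)%N -> Vs r = Vs 0%N ->
  c ^+ r * n^-1 ^+ r.-1 * ((1 - r%:R * kap) * \prod_(i < r) card i) <=
  closed_chain w r.
Proof.
case: r => [|[|j]] // _ Vr; have n0 : 0 < n by rewrite ltr0n.
have [E [E0 Esum Ew]] := chain_lower j.
have -> : closed_chain w j.+2 =
    n^-1 * \sum_x \sum_z chain w j.+1 x z * w j.+1 z x.
  by rewrite /closed_chain mulr_sumr.
pose T x z := (ind 0%N x * inner j * ind j.+1 z) * (ind j.+1 z * ind j.+2 x)
      - E x z * (ind j.+1 z * ind j.+2 x)
      - (ind 0%N x * inner j * ind j.+1 z) * D j.+1 z x.
apply: le_trans (_ : n^-1 * \sum_x \sum_z (c ^+ j.+1 * n^-1 ^+ j) * c * T x z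
   <= _); last first.
  rewrite ler_wpM2l ?invr_ge0 ?(ltW n0) //.
  apply: ler_sum => x _; apply: ler_sum => z _.
  apply: prod_defect_le; rewrite ?chain_ge0 ?mulr_ge0 ?exprn_ge0 ?invr_ge0 ?ind_ge0 ?inner_ge0 //.
have -> : n^-1 * \sum_x \sum_z (c ^+ j.+1 * n^-1 ^+ j) * c * T x z =
    c ^+ j.+2 * n^-1 ^+ j.+2.-1 * \sum_x \sum_z T x z.
  have -> : c ^+ j.+2 * n^-1 ^+ j.+2.-1 = n^-1 * (c ^+ j.+1 * n^-1 ^+ j * c).
    by rewrite /= [c ^+ j.+2]exprSr [n^-1 ^+ j.+1]exprS; ring.
  rewrite -[RHS]mulrA; congr (_ * _); rewrite mulr_sumr.
  by apply: eq_bigr => x _; rewrite mulr_sumr.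
apply: ler_wpM2l.
  by apply: mulr_ge0; apply: exprn_ge0; rewrite // invr_ge0 ltW.
rewrite /T.
have -> : \sum_x \sum_z
   (ind 0 x * inner j * ind j.+1 z * (ind j.+1 z * ind j.+2 x) -
    E x z * (ind j.+1 z * ind j.+2 x) - ind 0 x * inner j * ind j.+1 z * D j.+1 z x) =
  \prod_(i < j.+2) card i - \sum_x \sum_z E x z * (ind j.+1 z * ind j.+2 x)
  - \sum_x \sum_z ind 0 x * inner j * ind j.+1 z * D j.+1 z x.
  rewrite innerE -(sum_ind 0) -(sum_ind j.+1) !mulr_suml -!sumrB.
  apply: eq_bigr => x _; rewrite mulr_sumr -!sumrB; apply: eq_bigr => z _.
  by rewrite Vr; case: (x \in _); case: (z \in _) => /=; ring.
have h1 : \sum_x \sum_z E x z * (ind j.+1 z * ind j.+2 x) <=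
    j.+1%:R * kap * \prod_(i < j.+2) card i.
  apply: le_trans Esum; apply: ler_sum => x _; apply: ler_sum => z _.
  rewrite ler_piMr //; do 2!case: (_ \in _); rewrite ?mulr1 ?mul0r ?mulr0 //.
have h2 : \sum_x \sum_z ind 0 x * inner j * ind j.+1 z * D j.+1 z x <=
    kap * \prod_(i < j.+2) card i.
  apply: le_trans (_ : inner j * \sum_z \sum_x D j.+1 z x <= _).
    rewrite exchange_big mulr_sumr; apply: ler_sum => z _ /=.
    rewrite mulr_sumr; apply: ler_sum => x _.
    have h : 0 <= inner j * D j.+1 z x by rewrite mulr_ge0 ?inner_ge0.
    by do 2!case: (_ \in _); rewrite ?mulr1 ?mul1r ?mul0r ?mulr0 ?mul0r.
  apply: le_trans (ler_wpM2l (inner_ge0 j) (D_sum _)) _.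
  rewrite Vr innerE le_eqVlt; apply/orP; left; apply/eqP; ring.
move: h1 h2; rewrite -[j.+2%:R]natr1; lra.
Qed.

End ModelCount.

(** * Walks, homomorphisms and disjoint parts *)

Section Walks.
Variables (V : finType) (e : nat -> rel V).

(** A step relation that depends on the position confines a walk to a prescribed
    sequence of vertex sets. *)
Fixpoint nwalk (j : nat) (x y : V) : nat :=
  if j is i.+1 then (\sum_z nwalk i x z * e i z y)%N else (x == y).

Definition closed_walks r : {set {ffun 'I_r -> V}} :=
  [set f : {ffun 'I_r -> V} | [forall i : 'I_r, e i (f i) (f (ordS i))]].

Definition is_walk (x : V) (s : seq V) : bool :=
  all (fun i => e i (nth x (x :: s) i) (nth x s i)) (iota 0 (size s)).

Lemma is_walk_rcons x s y :
  is_walk x (rcons s y) = is_walk x s && e (size s) (last x s) y.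
Proof.
rewrite /is_walk size_rcons -[(size s).+1]addn1 iotaD all_cat add0n /= andbT.
congr (_ && _); last first.
  by rewrite nth_rcons ltnn eqxx -rcons_cons nth_rcons /= ltnSn -last_nth.
apply: eq_in_all => i; rewrite mem_iota add0n => /andP[_ lti].
by rewrite -rcons_cons !nth_rcons lti /= ltnS ltnW.
Qed.

Lemma nwalk_le j x y :
  (nwalk j x y <= #|[set t : j.-tuple V | is_walk x t && (last x t == y)]|)%N.
Proof.
elim: j y => [|j IH] y /=.
  case: eqP => // <-; apply/card_gt0P; exists [tuple]; by rewrite inE /= eqxx.
apply: leq_trans (_ : #|[set t : j.-tuple V |
    is_walk x t && e j (last x t) y]| <= _)%N.
  rewrite -sum1dep_card (partition_big (fun t : j.-tuple V => last x t) predT) //=.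
  apply: leq_sum => z _; apply: leq_trans (leq_mul (IH z) (leqnn _)) _.
  case ezy: (e j z y); last by rewrite muln0.
  rewrite muln1 -sum1dep_card leq_eqVlt; apply/orP; left; apply/eqP.
  apply: eq_bigl => t; case: eqP => [->|_]; last by rewrite !andbF.
  by rewrite ezy !andbT.
have inj : injective (fun t : j.-tuple V => [tuple of rcons t y]).
  by move=> t u /(congr1 val) /= /rcons_inj [] /val_inj.
rewrite -(card_imset _ inj) subset_leq_card //; apply/subsetP => u.
case/imsetP => t; rewrite !inE => /andP[wt et] ->.
by rewrite /= is_walk_rcons last_rcons wt size_tuple et eqxx.
Qed.

Lemma closed_nwalk_le r : (0 < r)%N ->
  (\sum_x nwalk r x x <= #|closed_walks r|)%N.
Proof.
move=> r0.
pose P (u : V * r.-tuple V) := is_walk u.1 u.2 && (last u.1 u.2 == u.1).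
apply: leq_trans (_ : #|[set u | P u]| <= _)%N.
  rewrite -sum1dep_card -(pair_big_dep predT (fun x t => P (x, t)) (fun _ _ => 1%N)) /=.
  by apply: leq_sum => x _; rewrite sum1dep_card; exact: nwalk_le.
pose F (u : V * r.-tuple V) : {ffun 'I_r -> V} :=
  [ffun i : 'I_r => nth u.1 (u.1 :: u.2) i].
have Flast u : P u -> nth u.1 u.2 r.-1 = u.1.
  have nthp (a b : V) s k : (0 < k)%N -> nth a (b :: s) k = nth a s k.-1.
    by case: k.
  by case/andP=> _ /eqP; rewrite (last_nth u.1) size_tuple nthp.
have Fnext u (i : 'I_r) : P u -> F u (ordS i) = nth u.1 u.2 i.
  move=> Pu; rewrite ffunE /=; have [lti|] := ltnP i.+1 r.
    by rewrite modn_small.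
  move=> ler; have e0 : (i.+1 %% r = 0)%N.
    by rewrite (_ : i.+1 = r) ?modnn //; apply/eqP; rewrite eqn_leq ler ltn_ord.
  have ei : r.-1 = i :> nat by move: ler (ltn_ord i); lia.
  by rewrite e0 -ei Flast.
have injF : {in [set u | P u] &, injective F}.
  move=> u v; rewrite !inE => Pu Pv Fuv.
  have exy : u.1 = v.1.
    have := congr1 (fun f : {ffun 'I_r -> V} => f (Ordinal r0)) Fuv.
    by rewrite !ffunE.
  case: u v exy Pu Pv Fuv => [x s] [y t] /= <- Ps Pt Fst; congr (_, _).
  apply: val_inj; apply: (@eq_from_nth _ x); first by rewrite !size_tuple.
  move=> i; rewrite size_tuple => lti.
  have := Fnext _ (Ordinal lti) Ps; have := Fnext _ (Ordinal lti) Pt.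
  by rewrite Fst /= => -> ->.
rewrite -(card_in_imset injF) subset_leq_card //; apply/subsetP => f.
case/imsetP => u; rewrite inE => Pu ->; rewrite inE; apply/forallP => i.
rewrite Fnext // ffunE; case/andP: Pu => /allP wu _.
by apply: wu; rewrite mem_iota size_tuple /= ltn_ord.
Qed.

End Walks.

Lemma chain_nwalk (R : realFieldType) (V : finType) (e : nat -> rel V) (s : R)
    (b : nat -> V -> V -> R) j x y :
  (forall i x y, b i x y = s * (e i x y)%:R) ->
  chain b j x y = (#|V|)%:R * (s / (#|V|)%:R) ^+ j * (nwalk e j x y)%:R.
Proof.
move=> bE; elim: j y => [|j IH] y; first by rewrite /= expr0 mulr1.
have -> : chain b j.+1 x y = #|V|%:R^-1 * \sum_z chain b j x z * b j z y by [].
rewrite natr_sum !mulr_sumr; apply: eq_bigr => z _.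
by rewrite IH bE exprS natrM; ring.
Qed.

Lemma closed_chain_le (R : realFieldType) (V : finType) (e : nat -> rel V)
    (s : R) (b : nat -> V -> V -> R) r : (0 < r)%N -> 0 <= s ->
  (forall i x y, b i x y = s * (e i x y)%:R) ->
  closed_chain b r <=
  (#|V|)%:R * (s / (#|V|)%:R) ^+ r * (#|closed_walks e r|)%:R.
Proof.
move=> r0 s0 bE; rewrite /closed_chain.
under eq_bigr do rewrite (chain_nwalk _ _ _ bE).
rewrite -mulr_sumr -natr_sum ler_wpM2l ?mulr_ge0 ?exprn_ge0 ?divr_ge0 //.
by rewrite ler_nat closed_nwalk_le.
Qed.

Lemma closed_walks_hom (G : sgraph) r :
  (#|closed_walks (fun _ => @adj G) r| <= num_hom (cycle_graph r) G)%N.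
Proof.
apply: subset_leq_card; apply/subsetP => f; rewrite !inE => /forallP fw.
apply/forallP => i; apply/forallP => j; apply/implyP => /andP[_].
by case/orP => /eqP ->; [|rewrite adj_sym].
Qed.

(** Walks whose positions run through disjoint sets cannot repeat a vertex. *)
Lemma closed_walks_inj (G : sgraph) (e : nat -> rel G) (Vs : nat -> {set G}) r :
  (forall i x y, e i x y -> adj x y && (x \in Vs i)) ->
  (forall i j, i < j < r -> [disjoint Vs i & Vs j])%N ->
  (#|closed_walks e r| <= num_inj (cycle_graph r) G)%N.
Proof.
move=> eadj disj.
apply: subset_leq_card; apply/subsetP => f; rewrite !inE => /forallP fw.
have fV i : f i \in Vs i by case/andP: (eadj _ _ _ (fw i)).
have fA i : adj (f i) (f (ordS i)) by case/andP: (eadj _ _ _ (fw i)).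
apply/andP; split.
  apply/forallP => i; apply/forallP => j; apply/implyP => /andP[_].
  by case/orP => /eqP ->; [|rewrite adj_sym].
apply/injectiveP => i j; wlog lt_ij : i j / (i < j)%N => [th fij|].
  have [/th->|/th h|/val_inj] // := ltngtP i j; last by rewrite h.
move=> fij; have := disj i j; rewrite lt_ij ltn_ord => /(_ isT) /pred0P.
by move/(_ (f i)); rewrite /= fV fij fV.
Qed.

Lemma subset_of_card (V : finType) (A : {set V}) m : (m <= #|A|)%N ->
  exists2 B : {set V}, B \subset A & #|B| = m.
Proof.
move=> mA; exists [set x in take m (enum A)].
  by apply/subsetP => x; rewrite inE => /mem_take; rewrite mem_enum.
rewrite cardsE; have /card_uniqP -> := take_uniq m (enum_uniq A).
by rewrite size_takel // -cardE.
Qed.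

(** The labels may repeat, so one part may have to supply sets for several
    positions; a greedy choice succeeds when each set takes at most a fraction
    1/r of its part. *)
Lemma disjoint_selection (V T : finType) (p : V -> T) (t : nat -> T)
    (m : T -> nat) r :
  (forall i, (i < r)%N -> (r * m (t i) <= #|[set x | p x == t i]|)%N) ->
  exists Vs : nat -> {set V},
    (forall i x, (i < r)%N -> x \in Vs i -> p x = t i) /\
    (forall i, (i < r)%N -> #|Vs i| = m (t i)) /\
    (forall i j, (i < j < r)%N -> [disjoint Vs i & Vs j]).
Proof.
move=> big; suff main k : (k <= r)%N -> exists Vs : nat -> {set V},
    (forall i x, (i < k)%N -> x \in Vs i -> p x = t i) /\
    (forall i, (i < k)%N -> #|Vs i| = m (t i)) /\
    (forall i j, (i < j < k)%N -> [disjoint Vs i & Vs j]).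
  exact: main.
elim: k => [_|k IH kr].
  by exists (fun=> set0); split=> //; split=> // i j; rewrite ltn0 andbF.
have [Vs [Vp [Vc Vd]]] := IH (ltnW kr).
pose S := [set x | p x == t k]; pose U := \bigcup_(i < k) Vs i.
have SU : (#|S :&: U| <= k * m (t k))%N.
  apply: leq_trans (_ : #|\bigcup_(i < k) (S :&: Vs i)| <= _)%N.
    by rewrite /U big_distrr.
  apply: leq_trans (_ : \sum_(i < k) #|S :&: Vs i| <= _)%N.
    elim/big_rec2: _ => [|i a B _ le]; first by rewrite cards0.
    by rewrite (leq_trans (leq_card_setU _ _)) // leq_add2l.
  rewrite -[X in (_ <= X * _)%N]card_ord -sum_nat_const; apply: leq_sum => i _.
  have [tik|tik] := eqVneq (t i) (t k).
    by rewrite -tik -Vc // subset_leq_card // subsetIr.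
  rewrite (_ : S :&: Vs i = set0) ?cards0 //; apply/setP => x; rewrite !inE.
  by apply/negP => /andP[/eqP xk /Vp xi]; rewrite -xk xi ?eqxx // in tik.
have [B BS Bc] : exists2 B : {set V}, B \subset S :\: U & #|B| = m (t k).
  apply: subset_of_card; have := big k kr; rewrite -/S -(cardsID U S).
  have : (k.+1 * m (t k) <= r * m (t k))%N by rewrite leq_mul2r kr orbT.
  by move: SU; lia.
exists (fun i => if i == k then B else Vs i); split; last split.
- move=> i x; rewrite ltnS leq_eqVlt; case: eqP => [-> _|_ /=].
    by move/(subsetP BS); rewrite !inE => /andP[_ /eqP].
  exact: Vp.
- move=> i; rewrite ltnS leq_eqVlt; case: eqP => [-> _ //|_ /=]; exact: Vc.
- move=> i j /andP[ij]; rewrite ltnS leq_eqVlt; case: eqP => [jk _|_ /= jk].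
    rewrite -jk (ltn_eqF ij); apply/pred0P => x /=; apply/negP => /andP[xi].
    move/(subsetP BS); rewrite inE => /andP[/negP xU _]; apply: xU.
    have ik : (i < k)%N by rewrite -jk.
    by apply/bigcupP; exists (Ordinal ik).
  by rewrite (ltn_eqF (ltn_trans ij jk)); apply: Vd; rewrite ij.
Qed.

(** * Second moments and edges between sets *)

Lemma chain_const_sym (R : realFieldType) (V : finType) (a : V -> V -> R) j x y :
  (0 < #|V|)%N -> (forall x y, a x y = a y x) ->
  chain (fun=> a) j x y = chain (fun=> a) j y x.
Proof.
move=> V0 a_sym; elim: j x y => [|j IH] x y; first by rewrite /= eq_sym.
rewrite -[RHS]/(chain _ (1 + j) y x) chain_cat //.
rewrite -[LHS]/(_ * \sum_z chain _ j x z * a z y); congr (_ * _).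
by apply: eq_bigr => z _; rewrite chain1 // IH a_sym mulrC.
Qed.

(** Two k-walks with the same ends close up to a homomorphic image of the
    2k-cycle; this is how the bound on the number of such homomorphisms becomes a
    second moment bound. *)
Lemma chain_square_sum (R : realFieldType) (G : sgraph) (e : rel G) (s : R)
    (b : nat -> G -> G -> R) k :
  (0 < #|G|)%N -> (0 < k)%N -> 0 <= s -> symmetric e ->
  (forall x y, e x y -> adj x y) ->
  (forall i x y, 0 <= b i x y <= s * (e x y)%:R) ->
  \sum_x \sum_y chain b k x y ^+ 2 <=
  (#|G|)%:R ^+ 2 * (s / (#|G|)%:R) ^+ (2 * k) *
    (num_hom (cycle_graph (2 * k)) G)%:R.
Proof.
move=> V0 k0 s0 e_sym e_adj be.
pose a x y : R := s * (e x y)%:R.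
have a_sym x y : a x y = a y x by rewrite /a e_sym.
have n0 : 0 < (#|G|)%:R :> R by rewrite ltr0n.
apply: le_trans (_ : #|G|%:R * closed_chain (fun=> a) (k + k) <= _).
  rewrite /closed_chain mulr_sumr; apply: ler_sum => x _.
  rewrite chain_cat // mulVKf ?gt_eqF //; apply: ler_sum => y _.
  rewrite -[chain (shift _ _) _ _ _]/(chain (fun=> a) k y x).
  rewrite [chain _ k y x]chain_const_sym //.
  have b0 i u v : 0 <= b i u v by have /andP[] := be i u v.
  by rewrite expr2 ler_pM ?chain_ge0 // chain_mono.
rewrite addnn -mul2n expr2 -!mulrA ler_wpM2l //.
apply: le_trans (closed_chain_le (e := fun=> e) _ s0 (fun _ _ _ => erefl)) _.
  by rewrite muln_gt0.
rewrite -!mulrA !ler_wpM2l ?exprn_ge0 ?divr_ge0 // ler_nat.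
apply: leq_trans (closed_walks_hom G (2 * k)).
apply: subset_leq_card; apply/subsetP => f; rewrite !inE => /forallP fw.
by apply/forallP => i; apply: e_adj.
Qed.

Section EdgesBetween.
Variable G : sgraph.
Implicit Types (A B Z : {set G}).

(** The sets may overlap; an edge inside the intersection counts twice. *)
Definition edges_between A B : nat := (\sum_(x in A) \sum_(y in B) adj x y)%N.

Lemma edges_betweenC A B : edges_between A B = edges_between B A.
Proof.
rewrite /edges_between exchange_big; apply: eq_bigr => x _ /=.
by apply: eq_bigr => y _; rewrite adj_sym.
Qed.

Lemma card_splitting_sets (x y : G) : x != y ->
  (2 ^ #|G| <= 4 * #|[set Z : {set G} | (x \in Z) && (y \notin Z)]|)%N.
Proof.
move=> xy.
have card2 : #|~: [set x; y]| = (#|G| - 2)%N.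
  by rewrite cardsCs setCK cards2 xy.
have G2 : (2 <= #|G|)%N by rewrite -(_ : #|[set x; y]| = 2)%N ?max_card // cards2 xy.
have -> : #|G| = (2 + (#|G| - 2))%N by rewrite subnKC.
rewrite expnD leq_mul2l /= -card2 -card_powerset.
have inj : {in powerset (~: [set x; y]) &, injective (fun Z => x |: Z)}.
  move=> Z Z'; rewrite !powersetE => /subsetP Zs /subsetP Zs' ZZ.
  have out (W : {set G}) : {subset W <= ~: [set x; y]} -> x \notin W.
    by move=> Ws; apply/negP => /Ws; rewrite !inE eqxx.
  by rewrite -(setU1K (out _ Zs)) ZZ setU1K // out.
rewrite -(card_in_imset inj) subset_leq_card //; apply/subsetP => W /imsetP[Z].
rewrite powersetE => /subsetP Zs ->; rewrite !inE eqxx /= negb_or eq_sym xy /=.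
by apply/negP => /Zs; rewrite !inE eqxx orbT.
Qed.

(** Averaging over all [Z]: an ordered pair of distinct vertices is split by a
    quarter of them. *)
Lemma half_cut A B :
  exists Z, (edges_between A B <= 4 * edges_between (A :&: Z) (B :\: Z))%N.
Proof.
apply/existsP; apply/contraT; rewrite negb_exists => /forallP small.
have : (\sum_(Z : {set G}) (4 * edges_between (A :&: Z) (B :\: Z)).+1 <=
        \sum_(Z : {set G}) edges_between A B)%N.
  by apply: leq_sum => Z _; rewrite ltnNge small.
under eq_bigr do rewrite -addn1.
rewrite big_split /= sum_nat_const sum_nat_const muln1 -cardsT.
have -> : [set: {set G}] = powerset [set: G].
  by apply/setP => Z; rewrite !inE subsetT.
rewrite card_powerset cardsT -big_distrr /=.
have : (2 ^ #|G| * edges_between A B <=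
   4 * \sum_Z edges_between (A :&: Z) (B :\: Z))%N; last first.
  have : (0 < 2 ^ #|G|)%N by rewrite expn_gt0.
  move=> P0 h1 h2; have := leq_trans h2 h1.
  by rewrite -[X in (_ <= X)%N]addn0 leq_add2l leqNgt P0.
have -> : (\sum_Z edges_between (A :&: Z) (B :\: Z) =
   \sum_(x in A) \sum_(y in B) adj x y *
     #|[set Z : {set G} | (x \in Z) && (y \notin Z)]|)%N.
  rewrite /edges_between.
  transitivity (\sum_(Z : {set G}) \sum_(x in A) \sum_(y in B)
     adj x y * ((x \in Z) && (y \notin Z)))%N.
    apply: eq_bigr => Z _; rewrite big_mkcond [RHS]big_mkcond /=.
    apply: eq_bigr => x _; rewrite inE.
    case: (x \in A) => //=; case: (x \in Z) => /=; last first.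
      by rewrite big1 // => y _; rewrite muln0.
    rewrite big_mkcond [RHS]big_mkcond /=; apply: eq_bigr => y _.
    by rewrite inE; case: (y \in B); case: (y \in Z); rewrite //= ?muln0 ?muln1.
  rewrite exchange_big; apply: eq_bigr => x _; rewrite exchange_big /=.
  apply: eq_bigr => y _; rewrite -big_distrr /= -sum1dep_card.
  by congr (_ * _)%N; rewrite [RHS]big_mkcond; apply: eq_bigr => Z _; case: andP.
rewrite /edges_between !big_distrr; apply: leq_sum => x _.
rewrite !big_distrr; apply: leq_sum => y _ /=.
case axy: (adj x y); last by rewrite muln0.
rewrite muln1 mul1n card_splitting_sets //.
by apply: contraTneq axy => ->; rewrite adj_irr.
Qed.

(** For disjoint sets the bipartite graph between them embeds in [G]; for
    overlapping ones a vertex would be used on both sides. *)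
Lemma edges_between_ex_bip (F : graph_family) A B :
  family_free F G -> [disjoint A & B] ->
  (edges_between A B <= ex_bip #|A| #|B| F)%N.
Proof.
move=> Ffree disjAB.
pose E : {set 'I_#|A| * 'I_#|B|} :=
  [set q | adj (enum_val q.1) (enum_val q.2)].
pose phi (u : 'I_#|A| + 'I_#|B|) : G :=
  match u with inl i => enum_val i | inr j => enum_val j end.
have phi_inj : injective phi.
  case=> i; case=> j /= ij; first by rewrite (enum_val_inj ij).
  - have := pred0P disjAB (enum_val i); rewrite /= enum_valP ij enum_valP.
    by [].
  - have := pred0P disjAB (enum_val j); rewrite /= enum_valP -ij enum_valP.
    by [].
  - by rewrite (enum_val_inj ij).
have Efree : family_free F (bip_graph E).
  move=> H FH [f [f_inj f_hom]]; apply: (Ffree H FH).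
  exists (phi \o f); split; first exact: inj_comp.
  apply/forallP => x; apply/forallP => y; apply/implyP => axy.
  have := implyP (forallP (forallP f_hom x) y) axy => /=.
  case: (f x) => i; case: (f y) => j //=; rewrite inE //=.
  by rewrite adj_sym.
apply: leq_trans (_ : #|edges (bip_graph E)| <= _)%N; last first.
  apply: (@leq_bigmax_cond _ _ (fun E0 : {set 'I_#|A| * 'I_#|B|} =>
            #|edges (bip_graph E0)|) E).
  exact/asboolP.
apply: leq_trans (_ : #|E| <= _)%N; last first.
  have inj : injective (fun q : 'I_#|A| * 'I_#|B| =>
      [set (inl q.1 : bip_graph E); (inr q.2 : bip_graph E)]).
    move=> [i j] [i' j'] /= /setP eq; have := eq (inl i); have := eq (inr j).
    by rewrite !inE !eqxx /= => /esym/eqP[->] /esym; rewrite orbF => /eqP[->].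
  rewrite -(card_imset _ inj) subset_leq_card //; apply/subsetP => W /imsetP[q qE ->].
  apply/imsetP; exists (inl q.1 : bip_graph E, inr q.2 : bip_graph E) => //.
  by rewrite inE /= -surjective_pairing.
have -> : #|E| = (\sum_(i < #|A|) \sum_(j < #|B|)
    adj (enum_val i) (enum_val j))%N.
  rewrite -sum1_card big_mkcond pair_big /=; apply: eq_bigr => q _.
  by rewrite inE; case: ifP.
rewrite /edges_between big_enum_val; apply: leq_sum => i _.
by rewrite big_enum_val.
Qed.

End EdgesBetween.

(** * Consequences of quasi-smoothness *)

Section QuasiSmooth.
Variable R : realType.

(** [half_cut] reduces the bound to disjoint sets, at the price of a factor 4. The
    order of the two sets does not matter because alpha - 1 is at most 1, and the
    lower order term is relaxed to a power of the number of vertices. *)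
Lemma quasi_smooth_edges (alpha beta : R) (F : graph_family) :
  1 < alpha -> alpha < 2 -> 0 <= beta -> quasi_smooth alpha beta F ->
  exists2 c : R, 0 < c & forall G : sgraph, family_free F G ->
    forall A B : {set G}, (edges_between A B)%:R <=
      c * ((#|A|)%:R * (#|B|)%:R `^ (alpha - 1) + (#|G|)%:R `^ beta).
Proof.
move=> a1 a2 b0 [c [c0 ex_le]].
exists (4 * c); first by rewrite mulr_gt0.
have powle (x y : nat) (t : R) : 0 <= t -> (x <= y)%N -> x%:R `^ t <= y%:R `^ t.
  by move=> t0 xy; rewrite ge0_ler_powR ?nnegrE ?ler0n // ler_nat.
move=> G Ffree A B.
have disj (A' B' : {set G}) : [disjoint A' & B'] -> (edges_between A' B')%:R <=
    c * ((#|A'|)%:R * (#|B'|)%:R `^ (alpha - 1) + (#|G|)%:R `^ beta).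
  move=> dAB.
  have rhs0 : 0 <= c * ((#|A'|)%:R * (#|B'|)%:R `^ (alpha - 1) + (#|G|)%:R `^ beta).
    by rewrite mulr_ge0 ?(ltW c0) // addr_ge0 ?mulr_ge0 ?powR_ge0.
  have [A0|A0] := posnP #|A'|.
    move/eqP: A0; rewrite cards_eq0 => /eqP A0.
    by rewrite /edges_between A0 big_set0 -A0.
  have [B0|B0] := posnP #|B'|.
    move/eqP: B0; rewrite cards_eq0 => /eqP B0.
    by rewrite edges_betweenC /edges_between B0 big_set0 -B0.
  have [AB|BA] := leqP #|A'| #|B'|.
    apply: le_trans (_ : (ex_bip #|A'| #|B'| F)%:R <= _).
      by rewrite ler_nat edges_between_ex_bip.
    apply: le_trans (ex_le _ _ A0 AB) _.
    by rewrite ler_wpM2l ?(ltW c0) // lerD2l powle // max_card.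
  apply: le_trans (_ : (ex_bip #|B'| #|A'| F)%:R <= _).
    rewrite ler_nat edges_betweenC edges_between_ex_bip //.
    by rewrite disjoint_sym.
  apply: le_trans (ex_le _ _ B0 (ltnW BA)) _.
  rewrite ler_wpM2l ?(ltW c0) // lerD ?powle ?max_card //.
  have split_pow (x : nat) : (0 < x)%N ->
      x%:R = x%:R `^ (2 - alpha) * x%:R `^ (alpha - 1) :> R.
    move=> x0; rewrite -powRD; last first.
      by apply/implyP => _; rewrite pnatr_eq0 -lt0n.
    by rewrite (_ : 2 - alpha + (alpha - 1) = 1) ?powRr1 //; ring.
  (* With a and b the sizes of A' and B', and b smaller than a:
     b a^(alpha-1) = b^(2-alpha) (a b)^(alpha-1)
                  <= a^(2-alpha) (a b)^(alpha-1) = a b^(alpha-1). *)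
  rewrite {1}(split_pow _ B0) {2}(split_pow _ A0) mulrAC.
  by rewrite ler_wpM2r ?powR_ge0 // ler_wpM2r ?powR_ge0 // powle ?(ltnW BA) // subr_ge0 ltW.
have [Z hZ] := half_cut A B.
apply: le_trans (_ : (4 * edges_between (A :&: Z) (B :\: Z))%:R <= _).
  by rewrite ler_nat.
rewrite natrM -mulrA ler_wpM2l //.
apply: le_trans (disj _ _ _) _.
  apply/pred0P => x /=; rewrite !inE; case: (x \in Z); rewrite ?andbF //.
rewrite ler_wpM2l ?(ltW c0) // lerD2r ler_pM ?powR_ge0 //.
  by rewrite ler_nat subset_leq_card // subsetIl.
by rewrite powle ?subset_leq_card ?subsetDl // subr_ge0 ltW.
Qed.

Lemma powR_eventually_le (alpha beta x : R) : beta < alpha -> 0 < x ->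
  exists2 n0 : nat, (0 < n0)%N &
    forall n : nat, (n0 <= n)%N -> n%:R `^ beta <= x * n%:R `^ alpha.
Proof.
move=> ba x0; have ab0 : 0 < alpha - beta by rewrite subr_gt0.
pose y := x^-1 `^ (alpha - beta)^-1.
exists (Num.bound y).+1 => // n nn.
have n1 : (0 < n)%N by apply: leq_trans nn.
have n0 : 0 < n%:R :> R by rewrite ltr0n.
have -> : n%:R `^ alpha = n%:R `^ (alpha - beta) * n%:R `^ beta.
  by rewrite -powRD ?subrK //; apply/implyP => _; rewrite gt_eqF.
rewrite mulrA ler_peMl ?powR_ge0 // -ler_pdivrMl // mulr1.
have -> : x^-1 = y `^ (alpha - beta).
  by rewrite -powRrM mulVf ?gt_eqF // powRr1 // invr_ge0 ltW.
have y0 : 0 <= y by apply: powR_ge0.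
rewrite ge0_ler_powR ?nnegrE ?(ltW ab0) ?ler0n //.
apply: ltW; apply: lt_le_trans (archi_boundP y0) _.
by rewrite ler_nat ltnW.
Qed.

(** This is where quasi-smoothness excludes a concentration of edges on few
    blocks. Let B be the union of the parts that form a too dense block with a
    part S. If |B| is at most th n, the bound on the edges between S and B gains the factor
    th^(alpha-1). Otherwise these edges number at least L th d |S|, hence at
    least 2 c d |S|, and only the lower order term can account for them. *)
Lemma dense_blocks_few_edges (V T : finType) (p : V -> T) (e : rel V)
    (alpha beta c th L : R) :
  let N : R := (#|V|)%:R in let d := N `^ (alpha - 1) in
  let a x y := N / d * (e x y)%:R in
  (0 < #|V|)%N -> 1 < alpha -> 0 < c -> 0 < th <= 1 -> 2 * c <= L * th ->
  (forall A B : {set V}, \sum_(x in A) \sum_(y in B) (e x y)%:R <=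
     c * ((#|A|)%:R * (#|B|)%:R `^ (alpha - 1) + N `^ beta)) ->
  \sum_x \sum_(y | L < block_mean p a x y) (e x y)%:R <=
    c * th `^ (alpha - 1) * (N * d) + 2 * c * (#|T|)%:R * N `^ beta.
Proof.
move=> N d a V0 a1 c0 /andP[th0 th1] cL e_le.
have N0 : 0 < N by rewrite ltr0n.
have d0 : 0 < d by rewrite powR_gt0.
have aN x y : 0 <= a x y by rewrite mulr_ge0 ?divr_ge0 // ltW.
have L0 : 0 <= L by rewrite -(pmulr_lge0 L th0) (le_trans _ cL) // mulr_ge0 // ltW.
pose S t := [set x | p x == t].
pose Bt t := [set y | [exists x, (p x == t) && (L < block_mean p a x y)]].
have BtE x y : (y \in Bt (p x)) = (L < block_mean p a x y).
  rewrite inE; apply/existsP/idP => [[z /andP[/eqP pz]]|lt].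
    by rewrite (block_mean_block _ pz (erefl (p y))).
  by exists x; rewrite eqxx.
rewrite (partition_big p predT) //=.
have block t : \sum_(x | p x == t) \sum_(y | L < block_mean p a x y) (e x y)%:R <=
    c * th `^ (alpha - 1) * d * (#|S t|)%:R + 2 * c * N `^ beta.
  have -> : \sum_(x | p x == t) \sum_(y | L < block_mean p a x y) (e x y)%:R =
      \sum_(x in S t) \sum_(y in Bt t) (e x y)%:R :> R.
    apply: eq_big => [x|x /eqP xt]; first by rewrite inE.
    by apply: eq_bigl => y; rewrite -BtE xt.
  set E := \sum_(x in S t) _.
  have E_le := e_le (S t) (Bt t); rewrite -/E in E_le.
  have S0 : 0 <= (#|S t|)%:R :> R by [].
  have nb0 : 0 <= N `^ beta by exact: powR_ge0.
  have [small|big] := lerP (#|Bt t|)%:R (th * N).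
    have : (#|Bt t|)%:R `^ (alpha - 1) <= th `^ (alpha - 1) * d.
      rewrite -powRM ?(ltW th0) ?(ltW N0) // ge0_ler_powR ?nnegrE //.
        by rewrite subr_ge0 ltW.
      by rewrite mulr_ge0 ?ltW.
    move/(ler_wpM2l S0)/(ler_wpM2l (ltW c0)).
    have : 0 <= c * N `^ beta by rewrite mulr_ge0 // ltW.
    by move: E_le; rewrite !mulrDr; lra.
  have lower : L * (#|S t|)%:R * (#|Bt t|)%:R <= N / d * E.
    have gp x y x' y' : p x = p x' -> p y = p y' ->
        ((x \in S t) && (y \in Bt t))%:R = ((x' \in S t) && (y' \in Bt t))%:R :> R.
      move=> px py; rewrite !inE px.
      suff -> : [exists x0, (p x0 == t) && (L < block_mean p a x0 y)] =
                [exists x0, (p x0 == t) && (L < block_mean p a x0 y')] by [].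
      by apply: eq_existsb => z; rewrite (block_mean_block a (erefl (p z)) py).
    have := @sum_block_mean _ _ _ p a (fun w => ((w.1 \in S t) && (w.2 \in Bt t))%:R) gp.
    have -> : \sum_w ((w.1 \in S t) && (w.2 \in Bt t))%:R * a w.1 w.2 = N / d * E.
      rewrite /E mulr_sumr -(pair_big predT predT (fun x y =>
         ((x \in S t) && (y \in Bt t))%:R * a x y)) /= [RHS]big_mkcond.
      apply: eq_bigr => x _; case: (x \in S t) => /=; last first.
        by rewrite big1 // => y _; rewrite mul0r.
      rewrite mulr_sumr [RHS]big_mkcond; apply: eq_bigr => y _.
      by case: (y \in Bt t); rewrite ?mul1r ?mul0r.
    move=> <-.
    rewrite -(pair_big predT predT (fun x y =>
         ((x \in S t) && (y \in Bt t))%:R * block_mean p a x y)) /=.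
    rewrite -sum1_card natr_sum mulr_sumr mulr_suml big_mkcond.
    apply: ler_sum => x _; case: ifP => [xS|_ /=]; last first.
      by rewrite sumr_ge0 // => y _; rewrite mul0r.
    rewrite mulr1 -sum1_card natr_sum mulr_sumr big_mkcond.
    apply: ler_sum => y _; case: ifP => [yB|_] /=; last by rewrite mul0r.
    rewrite mulr1 mul1r ltW // -BtE.
    by move: xS; rewrite inE => /eqP ->.
  have le1 : (#|Bt t|)%:R `^ (alpha - 1) <= d.
    rewrite /d ge0_ler_powR ?nnegrE ?ler_nat ?max_card ?(ltW N0) //.
    by rewrite subr_ge0 ltW.
  have h1 : 2 * c * d * (#|S t|)%:R <= E.
    have : L * (#|S t|)%:R * (th * N) <= N / d * E.
      apply: le_trans lower; apply: ler_wpM2l (ltW big).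
      by rewrite mulr_ge0.
    have -> : L * (#|S t|)%:R * (th * N) = N * ((L * th) * (#|S t|)%:R) by ring.
    have -> : N / d * E = N * (E / d) by rewrite mulrAC mulrA.
    rewrite ler_pM2l // ler_pdivlMr // => h; apply: le_trans h.
    have -> : 2 * c * d * (#|S t|)%:R = 2 * c * ((#|S t|)%:R * d) by ring.
    by rewrite -[leRHS]mulrA ler_wpM2r // mulr_ge0 // ltW.
  have h2 : E <= c * d * (#|S t|)%:R + c * N `^ beta.
    apply: le_trans E_le _; rewrite mulrDr lerD2r -mulrA ler_wpM2l ?(ltW c0) //.
    by rewrite mulrC ler_wpM2r.
  have : 0 <= c * th `^ (alpha - 1) * d * (#|S t|)%:R.
    by rewrite !mulr_ge0 ?powR_ge0 // ltW.
  have h3 : 2 * c * d * (#|S t|)%:R = 2 * (c * d * (#|S t|)%:R) by ring.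
  by rewrite -mulrA; move: h1 h2; rewrite h3; lra.
apply: le_trans (ler_sum _ (fun t _ => block t)) _.
rewrite big_split /= -mulr_sumr sumr_const -natr_sum.
have -> : (\sum_t #|S t| = #|V|)%N.
  rewrite -sum1_card (partition_big p predT) //=; apply: eq_bigr => t _.
  by rewrite -sum1_card; apply: eq_bigl => x; rewrite inE.
rewrite -[X in _ + X]mulr_natr le_eqVlt; apply/orP; left; apply/eqP.
by rewrite -/N; ring.
Qed.

End QuasiSmooth.

(** * Few edges lie in bad blocks *)

Section Cleaning.
Variables (R : rcfType) (V T : finType) (p : V -> T) (e : rel V).
Variables (N d g eps L kap : R) (u : V -> V -> R).

Let a x y : R := N / d * (e x y)%:R.
Let part x : R := (#|[set z | p z == p x]|)%:R.

(** [u] is the pointwise change of the block means when [p] is refined, so that the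
    last condition says that the block is nearly homogeneous for the refinement. *)
Definition good_pair (x y : V) : bool :=
  [&& g * N <= part x, g * N <= part y, eps <= block_mean p a x y,
      block_mean p a x y <= L & block_mean p u x y <= kap].

Hypothesis N_gt0 : 0 < N.
Hypothesis d_gt0 : 0 < d.
Hypothesis g_ge0 : 0 <= g.
Hypothesis card_V : (#|V|)%:R = N.

Lemma small_parts_sum : \sum_(x | part x < g * N) 1 <= (#|T|)%:R * (g * N).
Proof.
rewrite (partition_big p predT) //= mulr_natl -sumr_const.
apply: ler_sum => t _.
have [x /andP[small /eqP xt]|none] := pickP (fun x => (part x < g * N) && (p x == t)).
  apply: le_trans (ltW small); rewrite /part xt -sumr_const big_mkcond [leRHS]big_mkcond.
  apply: ler_sum => z _; rewrite inE; case: (p z == t); rewrite ?andbF ?andbT //.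
  by case: ifP.
by rewrite big_pred0 // mulr_ge0 // ltW.
Qed.

Lemma sum_edges_block (Q : pred (V * V)) :
  (forall x y x' y', p x = p x' -> p y = p y' -> Q (x, y) = Q (x', y')) ->
  \sum_(w | Q w) (e w.1 w.2)%:R = d / N * \sum_(w | Q w) block_mean p a w.1 w.2.
Proof.
move=> Qp.
have -> : \sum_(w | Q w) block_mean p a w.1 w.2 =
    \sum_w (Q w)%:R * block_mean p a w.1 w.2.
  by rewrite big_mkcond; apply: eq_bigr => w _; case: (Q w); rewrite ?mul1r ?mul0r.
rewrite (@sum_block_mean _ _ _ p a (fun w => (Q w)%:R)); last first.
  by move=> x y x' y' px py; rewrite (Qp x y x' y').
rewrite big_mkcond mulr_sumr; apply: eq_bigr => w _.
case: (Q w); rewrite ?mul0r ?mulr0 // mul1r /a.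
by field; rewrite !gt_eqF.
Qed.

Lemma few_bad_pairs (D B del : R) (m : nat) :
  symmetric e -> 0 <= D -> (forall x, \sum_y (e x y)%:R <= D) -> (#|T| <= m)%N ->
  0 <= eps -> 0 < kap -> 0 <= L -> (forall x y, 0 <= u x y) ->
  \sum_x \sum_(y | L < block_mean p a x y) (e x y)%:R <= B ->
  \sum_(w : V * V | block_mean p a w.1 w.2 <= L) u w.1 w.2 <= del * N ^+ 2 ->
  \sum_(w : V * V | ~~ good_pair w.1 w.2) (e w.1 w.2)%:R <=
    2 * (m%:R * (g * N)) * D + eps * (N * d) + B + L * (del / kap) * (N * d).
Proof.
move=> e_sym D0 eD Tm eps0 kap0 L0 u0 dense dev.
have sumN2 : \sum_(w : V * V) (1 : R) = N ^+ 2.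
  by rewrite sumr_const card_prod natrM card_V expr2.
have split_sum (Q : pred (V * V)) : \sum_(w | Q w) (e w.1 w.2)%:R =
    \sum_w ((Q w)%:R * (e w.1 w.2)%:R) :> R.
  by rewrite big_mkcond; apply: eq_bigr => w _; case: (Q w); rewrite ?mul1r ?mul0r.
have h1 : \sum_(w : V * V | part w.1 < g * N) (e w.1 w.2)%:R <= m%:R * (g * N) * D.
  apply: le_trans (_ : \sum_(x | part x < g * N) D <= _).
    rewrite (eq_bigl (fun w : V * V => (part w.1 < g * N) && true)); last first.
      by move=> w; rewrite andbT.
    rewrite -(pair_big (fun x => part x < g * N) xpredT (fun x y => (e x y)%:R)) /=.
    by apply: ler_sum => x _; exact: eD.
  have -> : \sum_(x | part x < g * N) D = (\sum_(x | part x < g * N) 1) * D.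
    by rewrite mulr_suml; apply: eq_bigr => x _; rewrite mul1r.
  rewrite ler_wpM2r //.
  apply: le_trans small_parts_sum _.
  by rewrite ler_wpM2r ?mulr_ge0 ?(ltW N_gt0) // ler_nat.
have h2 : \sum_(w : V * V | part w.2 < g * N) (e w.1 w.2)%:R <= m%:R * (g * N) * D.
  apply: le_trans h1; rewrite le_eqVlt; apply/orP; left; apply/eqP.
  have swap : involutive (fun w : V * V => (w.2, w.1)) by case.
  rewrite (reindex_inj (inv_inj swap)) /=.
  by apply: eq_bigr => w _; rewrite e_sym.
have h3 : \sum_(w : V * V | block_mean p a w.1 w.2 < eps) (e w.1 w.2)%:R <= eps * (N * d).
  rewrite sum_edges_block => [|x y x' y' px py]; last first.
    by rewrite /= (block_mean_block a px py).
  apply: le_trans (_ : d / N * (eps * N ^+ 2) <= _); last first.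
    by rewrite le_eqVlt; apply/orP; left; apply/eqP; field; rewrite gt_eqF.
  rewrite ler_wpM2l ?divr_ge0 ?(ltW d_gt0) ?(ltW N_gt0) //.
  rewrite -sumN2 mulr_sumr big_mkcond; apply: ler_sum => w _.
  by case: ifP; rewrite mulr1 // => /ltW.
have h4 : \sum_(w : V * V | L < block_mean p a w.1 w.2) (e w.1 w.2)%:R <= B.
  by apply: le_trans dense; rewrite (pair_big_dep _ _ (fun x y => (e x y)%:R)).
pose Q (w : V * V) := (block_mean p a w.1 w.2 <= L) && (kap < block_mean p u w.1 w.2).
have h5 : \sum_(w | Q w) (e w.1 w.2)%:R <= L * (del / kap) * (N * d).
  rewrite sum_edges_block => [|x y x' y' px py]; last first.
    by rewrite /Q /= (block_mean_block a px py) (block_mean_block u px py).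
  have Qcard : \sum_(w | Q w) 1 <= del / kap * N ^+ 2.
    rewrite mulrAC ler_pdivlMr //; apply: le_trans dev.
    have -> : \sum_(w : V * V | block_mean p a w.1 w.2 <= L) u w.1 w.2 =
        \sum_(w : V * V) (block_mean p a w.1 w.2 <= L)%R%:R * u w.1 w.2.
      by rewrite big_mkcond; apply: eq_bigr => w _; case: ifP; rewrite ?mul1r ?mul0r.
    rewrite -(@sum_block_mean _ _ _ p u (fun w => (block_mean p a w.1 w.2 <= L)%R%:R)); last first.
      by move=> x y x' y' px py /=; rewrite (block_mean_block a px py).
    rewrite mulr_suml big_mkcond; apply: ler_sum => w _; rewrite /Q mul1r.
    have bu := block_mean_ge0 p w.1 w.2 u0.
    case: (block_mean p a w.1 w.2 <= L); rewrite ?mul0r //= mul1r.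
    by case: ifP => // /ltW.
  apply: le_trans (_ : d / N * (L * (del / kap * N ^+ 2)) <= _); last first.
    by rewrite le_eqVlt; apply/orP; left; apply/eqP; field; rewrite !gt_eqF.
  rewrite ler_wpM2l ?divr_ge0 ?(ltW d_gt0) ?(ltW N_gt0) //.
  apply: le_trans (ler_wpM2l L0 Qcard); rewrite mulr_sumr mulr1.
  by apply: ler_sum => w /andP[].
move: h1 h2 h3 h4 h5; rewrite !split_sum => h1 h2 h3 h4 h5.
have -> : 2 * (m%:R * (g * N)) * D + eps * (N * d) + B + L * (del / kap) * (N * d) =
   m%:R * (g * N) * D + m%:R * (g * N) * D + eps * (N * d) + B + L * (del / kap) * (N * d).
  by ring.
apply: le_trans (lerD (lerD (lerD (lerD h1 h2) h3) h4) h5).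
rewrite -!big_split; apply: ler_sum => w _ /=; rewrite -!mulrDl.
have bools a1 a2 a3 a4 a5 : (~~ [&& a1, a2, a3, a4 & a5] <=
    ~~ a1 + ~~ a2 + ~~ a3 + ~~ a4 + (a4 && ~~ a5))%N.
  by case: a1 a2 a3 a4 a5 => [] [] [] [] [].
apply: ler_wpM2r => //; rewrite -!natrD ler_nat /Q.
rewrite (ltNge (part w.1)) (ltNge (part w.2)) (ltNge _ eps) (ltNge L) (ltNge kap).
exact: bools.
Qed.

End Cleaning.

(** * Injective cycles from a closed walk through good blocks *)

Lemma half_divn (R : realFieldType) (s r : nat) : (0 < r)%N -> (r <= s)%N ->
  s%:R <= (2 * r)%:R * (s %/ r)%:R :> R.
Proof.
move=> r0 rs; rewrite -natrM ler_nat.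
have : (0 < s %/ r)%N by rewrite divn_gt0.
have := divn_eq s r; have := ltn_pmod s r0; nia.
Qed.

Lemma block_sum (R : rcfType) (V T : finType) (p : V -> T) (u : V -> V -> R) x0 y0 :
  \sum_(x | p x == p x0) \sum_(y | p y == p y0) u x y =
  (#|[set x | p x == p x0]|)%:R * (#|[set y | p y == p y0]|)%:R *
    block_mean p u x0 y0.
Proof.
have eqp (v : V * V) : ((p v.1, p v.2) == (p x0, p y0)) =
    (p v.1 == p x0) && (p v.2 == p y0) by rewrite xpair_eqE.
rewrite /block_mean /fibre_mean /= (eq_bigl _ _ eqp).
have -> : #|[pred v : V * V | (p v.1, p v.2) == (p x0, p y0)]| =
    (#|[set x | p x == p x0]| * #|[set y | p y == p y0]|)%N.
  by rewrite -cardsX; apply: eq_card => v; rewrite !inE eqp.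
rewrite natrM mulrC divfK.
  by rewrite pair_big_dep.
by rewrite mulf_neq0 // pnatr_eq0 -lt0n; apply/card_gt0P;
  [exists x0 | exists y0]; rewrite inE.
Qed.

Section GoodClosedWalk.
Variables (R : realType) (G : sgraph) (e : rel G) (T T' : finType).
Variables (p : G -> T) (p' : G -> T') (k : nat).
Variables (d g eps L kap M C psi : R) (s : nat -> G).
Local Notation N := ((#|G|)%:R : R).
Local Notation r := (k.+1 + k)%N.

Let a x y : R := N / d * (e x y)%:R.
Let u x y : R := `|block_mean p' a x y - block_mean p a x y|.
Let rho : R := (eps / 2) ^+ r / 2 * (g / (2 * r)%:R) ^+ r.

(** Inside the parts along the walk choose disjoint sets U i of a fixed proportion.
    The block means of the refinement [p'], cut off at 2 L, form a bounded model
    that is at least eps / 2 on most of U i x U (i + 1), and so carries a positive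
    density of closed chains; [transfers] moves this to the graph itself. *)
Lemma num_inj_of_good_closed_walk :
  (0 < #|G|)%N -> (0 < k)%N -> 0 < d -> 0 <= g -> 0 < eps -> eps <= L ->
  symmetric e -> (forall x y, e x y -> adj x y) ->
  (forall x, \sum_y (e x y)%:R <= M * d) ->
  r%:R <= g * N ->
  kap <= eps / (16 * r%:R ^+ 3) ->
  cut_le (psi * N ^+ 2) (deviation (2 * L) p' a) ->
  transfers k (2 * L) M C rho psi ->
  (num_hom (cycle_graph (2 * k)) G)%:R <= C * d ^+ (2 * k) ->
  (forall i, (i < r)%N -> good_pair p e N d g eps L kap u (s i) (s (i.+1 %% r))) ->
  rho / 2 * d ^+ r <= (num_inj (cycle_graph r) G)%:R.
Proof.
move=> V0 k0 d0 g0 eps0 epsL e_sym e_adj eM rgN kap_le cut tr hom_le walk.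
have N0 : 0 < N by rewrite ltr0n.
have r0 : (0 < r)%N by [].
have rR : 0 < r%:R :> R by rewrite ltr0n.
have sd0 : 0 <= N / d by rewrite divr_ge0 // ltW.
have a0 x y : 0 <= a x y by rewrite mulr_ge0.
have L0 : 0 < L by exact: lt_le_trans epsL.
have u0 x y : 0 <= u x y by exact: normr_ge0.
pose S t := [set x | p x == t].
pose mt t := (#|S t| %/ r)%N.
have big t : (r * mt t <= #|S t|)%N by rewrite mulnC leq_divM.
have [Vs [Vp [Vc Vd]]] := @disjoint_selection G T p (fun i => p (s i)) mt r
  (fun i _ => big (p (s i))).
pose U i := Vs (i %% r)%N.
have modr i : (i %% r < r)%N by rewrite ltn_mod.
pose si i := s (i %% r)%N.
have walk' i : good_pair p e N d g eps L kap u (si i) (si i.+1).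
  have e1 : ((i %% r).+1 %% r = i.+1 %% r)%N.
    by rewrite -[(i %% r).+1]addn1 modnDml addn1.
  by have := walk _ (modr i); rewrite e1.
have pU i x : x \in U i -> p x = p (si i) by exact: Vp.
have sizeU i : (#|S (p (si i))|)%:R <= (2 * r)%:R * (#|U i|)%:R :> R.
  rewrite /U Vc // /mt; apply: half_divn => //.
  have := walk' i; case/and5P=> gN _ _ _ _.
  by rewrite -(ler_nat R); apply: le_trans rgN gN.
pose a1 x y := block_mean p' a x y.
have a10 x y : 0 <= a1 x y by exact: block_mean_ge0.
pose ok x y := (eps / 2 <= a1 x y) && (a1 x y <= 2 * L).
pose D i x y : R := ((x \in U i) && (y \in U i.+1) && ~~ ok x y)%:R.
pose w i x y : R :=
  if (x \in U i) && (y \in U i.+1) && (a1 x y <= 2 * L) then a1 x y else 0.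
pose e' i x y := [&& e x y, x \in U i, y \in U i.+1 & a1 x y <= 2 * L].
pose b i x y : R := N / d * (e' i x y)%:R.
have D0 i x y : 0 <= D i x y by [].
have w0 i x y : 0 <= w i x y by rewrite /w; case: ifP.
have wL i x y : 0 <= w i x y <= 2 * L.
  by rewrite w0 /=; rewrite /w; case: ifP => [/andP[]//|_]; rewrite mulr_ge0 // ltW.
have b0 i x y : 0 <= b i x y by rewrite mulr_ge0.
have be i x y : 0 <= b i x y <= N / d * (e x y)%:R.
  by rewrite b0 ler_wpM2l // ler_nat; case: (boolP (e' i x y)) => // /and4P[->].
(* A defective pair moves the block mean by at least eps / 2, and the pairs U i x
   U (i + 1) fill at least a fraction 1 / (2 r)^2 of their block; the bound on kap
   leaves a proportion 1 / (2 r) of defects per step, hence 1 / 2 for the walk. *)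
have D_sum i : \sum_x \sum_y D i x y <=
    (2 * r)%:R^-1 * ((#|U i|)%:R * (#|U i.+1|)%:R).
  have e20 : 0 < eps / 2 by rewrite divr_gt0.
  rewrite -(ler_pM2r e20).
  apply: le_trans (_ : kap * ((#|S (p (si i))|)%:R * (#|S (p (si i.+1))|)%:R) <= _).
    apply: le_trans (_ : \sum_(x | p x == p (si i)) \sum_(y | p y == p (si i.+1)) u x y <= _).
      rewrite mulr_suml [leRHS]big_mkcond; apply: ler_sum => x _.
      rewrite mulr_suml; case: ifP => [_|/negP px]; last first.
        rewrite big1 // => y _; rewrite /D; case xU: (x \in U i).
          by case: px; rewrite (pU _ _ xU).
        by rewrite mul0r.
      rewrite [leRHS]big_mkcond; apply: ler_sum => y _; rewrite /D.
      case xU: (x \in U i); last by rewrite /= mul0r; case: ifP; rewrite // u0.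
      case yU: (y \in U i.+1); last by rewrite /= mul0r; case: ifP; rewrite // u0.
      rewrite (pU _ _ yU) eqxx /=; case okxy: (ok x y); first by rewrite mul0r.
      rewrite mul1r /u -/(a1 x y).
      have := walk' i; case/and5P=> _ _ lo hi _.
      rewrite (block_mean_block a (pU _ _ xU) (pU _ _ yU)).
      move: lo hi okxy; rewrite /ok; set m0 := block_mean p a _ _ => lo hi okxy.
      rewrite ler_normr; move: okxy; case: (lerP (eps / 2) (a1 x y)) => /= [_|h1 _].
        move/negbT; rewrite -ltNge => h2.
        by apply/orP; left; move: lo hi h2 epsL; lra.
      by apply/orP; right; move: lo hi h1; lra.
    rewrite block_sum mulrC ler_wpM2r ?mulr_ge0 //.
    by have := walk' i; case/and5P.
  apply: le_trans (_ : eps / (16 * r%:R ^+ 3) *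
     (((2 * r)%:R * (#|U i|)%:R) * ((2 * r)%:R * (#|U i.+1|)%:R)) <= _).
    apply: le_trans (_ : eps / (16 * r%:R ^+ 3) *
        ((#|S (p (si i))|)%:R * (#|S (p (si i.+1))|)%:R) <= _).
      by rewrite ler_wpM2r ?mulr_ge0.
    rewrite ler_wpM2l ?divr_ge0 ?mulr_ge0 ?exprn_ge0 ?(ltW eps0) //.
    by rewrite ler_pM.
  rewrite natrM; move: (r%:R : R) rR => rr rr0.
  by rewrite le_eqVlt; apply/orP; left; apply/eqP; field; rewrite gt_eqF.
have w_lower i x y : eps / 2 * ((x \in U i)%:R * (y \in U i.+1)%:R - D i x y) <= w i x y.
  rewrite /D /w /ok; case: (x \in U i) => /=; last by rewrite mul0r subrr mulr0.
  case: (y \in U i.+1) => /=; last by rewrite mulr0 subrr mulr0.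
  case: (lerP (eps / 2) _) => h1 /=; last by rewrite mulr1 subrr mulr0; case: ifP.
  by case: ifP => /= _; rewrite ?mulr1 ?subr0 ?mulr1 ?subrr ?mulr0.
have e20 : 0 <= eps / 2 by rewrite divr_ge0 ?(ltW eps0).
have Ur : U r = U 0%N by rewrite /U modnn mod0n.
have r1 : (1 < r)%N by rewrite addSn ltnS; case: (k) k0.
have main := closed_chain_lower V0 e20 w0 D0 D_sum w_lower r1 Ur.
have rho_le : rho * N <= closed_chain w r.
  apply: le_trans main.
  have -> : 1 - r%:R * (2 * r)%:R^-1 = 2^-1 :> R.
    by rewrite natrM; move: (r%:R : R) rR => rr rr0; field; rewrite gt_eqF.
  have prod_le : (g * N / (2 * r)%:R) ^+ r <= \prod_(i < r) (#|U i|)%:R.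
    rewrite -[X in _ ^+ X]card_ord -prodr_const; apply: ler_prod => i _.
    rewrite divr_ge0 ?mulr_ge0 //=.
    rewrite ler_pdivrMr ?ltr0n // [leRHS]mulrC; apply: le_trans (sizeU i).
    by have := walk' i; case/and5P.
  apply: le_trans (ler_wpM2l _ (ler_wpM2l _ prod_le)); last 2 first.
  - by rewrite mulr_ge0 // exprn_ge0 // invr_ge0.
  - by rewrite invr_ge0.
  have -> : (g * N / (2 * r)%:R) ^+ r = N * N ^+ r.-1 * (g / (2 * r)%:R) ^+ r.
    by rewrite -exprS prednK // -exprMn; congr (_ ^+ _); ring.
  have Nr : N^-1 ^+ r.-1 * N ^+ r.-1 = 1 by rewrite exprVn mulVf // expf_neq0 // gt_eqF.
  rewrite /rho.
  move: ((eps / 2) ^+ r) ((g / (2 * r)%:R) ^+ r) (N^-1 ^+ r.-1) (N ^+ r.-1) Nr => A B X Y XY.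
  have -> : A * X * (2^-1 * (N * Y * B)) = A / 2 * B * N * (X * Y) by ring.
  by rewrite XY mulr1.
have cut_b i : weak_le (psi * N ^+ 2) (fun x y => b i x y - w i x y).
  apply: cut_weak_le => X Y; apply: le_trans (cut (X :&: U i) (Y :&: U i.+1)).
  rewrite le_eqVlt; apply/orP; left; apply/eqP; congr `|_|.
  rewrite big_mkcond [RHS]big_mkcond; apply: eq_bigr => x _; rewrite inE.
  case: (x \in X) => //=; case xU: (x \in U i); last first.
    by rewrite big1 // => y _; rewrite /b /w /e' xU /= andbF mulr0 subrr.
  rewrite big_mkcond [RHS]big_mkcond; apply: eq_bigr => y _; rewrite inE.
  case: (y \in Y) => //=; case yU: (y \in U i.+1); last first.
    by rewrite /b /w /e' xU yU /= andbF mulr0 subrr.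
  rewrite /b /w /e' xU yU /deviation -/(a1 x y) /=.
  by case: ifP; rewrite ?andbT ?andbF // mulr0 subrr.
have bM i y : \sum_x b i x y <= M * N.
  apply: le_trans (_ : \sum_x N / d * (e y x)%:R <= _).
    by apply: ler_sum => x _; rewrite e_sym; have /andP[] := be i x y.
  rewrite -mulr_sumr; apply: le_trans (ler_wpM2l sd0 (eM y)) _.
  by rewrite le_eqVlt; apply/orP; left; apply/eqP; field; rewrite gt_eqF.
have sdE : N / d / N = d^-1 by field; rewrite !gt_eqF.
have square b' : (forall i x y, 0 <= b' i x y <= N / d * (e x y)%:R) ->
    \sum_x \sum_y chain b' k x y ^+ 2 <= C * N ^+ 2.
  move=> b'e; apply: le_trans (chain_square_sum V0 k0 sd0 e_sym e_adj b'e) _.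
  rewrite sdE -mulrA [leRHS]mulrC ler_wpM2l ?exprn_ge0 // exprVn mulrC.
  by rewrite ler_pdivrMr ?exprn_gt0.
have := tr _ b w V0 b0 bM wL cut_b (square _ be) (square _ (fun i => be _)) rho_le.
move=> /le_trans /(_ (closed_chain_le r0 sd0 (fun _ _ _ => erefl))).
rewrite sdE exprVn => low.
have walks_le : (#|closed_walks e' r| <= num_inj (cycle_graph r) G)%N.
  apply: (@closed_walks_inj G e' U) => [i x y /and4P[/e_adj -> -> _ _] //|i j].
  by move=> /andP[ij jr]; rewrite /U !modn_small ?Vd ?ij // (ltn_trans ij jr).
apply: le_trans (_ : (#|closed_walks e' r|)%:R <= _); last by rewrite ler_nat.
move: low; rewrite -[leRHS]mulrA [leRHS]mulrC ler_pM2r // [_^-1 * _]mulrC.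
by rewrite ler_pdivlMr ?exprn_gt0.
Qed.

End GoodClosedWalk.

(** * Odd cycles and vertices of high degree *)

(** Go once around the cycle, ending at its last vertex 2 l, and then back and
    forth along the edge that closes it. *)
Lemma odd_closed_walk (V : finType) (Q : rel V) (k l : nat)
    (f : cycle_graph (2 * l + 1) -> V) :
  symmetric Q -> (1 <= l <= k)%N ->
  (forall i j, cycle_adj i j -> Q (f i) (f j)) ->
  exists s : nat -> V, forall i, (i < k.+1 + k)%N ->
    Q (s i) (s (i.+1 %% (k.+1 + k))%N).
Proof.
move=> Q_sym /andP[l1 lk] fQ.
have z_lt : (0 < 2 * l + 1)%N by rewrite addn1.
pose z : 'I_(2 * l + 1) := Ordinal z_lt.
pose o i : 'I_(2 * l + 1) := insubd z i.
have oE i : (i < 2 * l + 1)%N -> o i = i :> nat by move=> lti; rewrite val_insubd lti.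
have next i : (i.+1 < 2 * l + 1)%N -> Q (f (o i)) (f (o i.+1)).
  move=> lti; apply: fQ; rewrite /cycle_adj -!val_eqE /= !oE ?(ltnW lti) //.
  by rewrite modn_small // eqxx neq_ltn ltnSn.
have back : Q (f (o (2 * l))) (f (o 0%N)).
  apply: fQ; rewrite /cycle_adj -!val_eqE /= !oE ?addn1 //.
  by rewrite modnn eqxx andbT; lia.
exists (fun i => if (i < 2 * l + 1)%N then f (o i)
                 else if odd i then f (o 0%N) else f (o (2 * l))).
move=> i ltik.
have [last|notlast] := eqVneq i.+1 (k.+1 + k)%N.
  rewrite -last modnn z_lt.
  have [lti|lei] := ltnP i (2 * l + 1).
    by rewrite (_ : i = 2 * l)%N //; lia.
  by rewrite (_ : odd i = false) //; lia.
rewrite modn_small; last by lia.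
have [lti|lei] := ltnP i.+1 (2 * l + 1).
  by rewrite (ltnW lti) next.
have [lti|lei'] := ltnP i (2 * l + 1).
  have -> : i = (2 * l)%N by lia.
  by rewrite (_ : odd (2 * l).+1 = true) //; lia.
by rewrite /=; case: (odd i) => /=; rewrite // Q_sym.
Qed.

Section HighDegree.
Variables (R : realType) (G : sgraph) (alpha beta c : R).
Local Notation N := ((#|G|)%:R : R).
Local Notation d := (N `^ (alpha - 1)).

(** Discarding these vertices bounds the degrees by a multiple of the scale d,
    which the telescoping of chains needs. *)
Definition high_degree : {set G} :=
  [set x | 2 * c * d < \sum_y (adj x y)%:R].

Definition low_adj : rel G :=
  fun x y => [&& adj x y, x \notin high_degree & y \notin high_degree].

Lemma low_adj_sym : symmetric low_adj.
Proof. by move=> x y; rewrite /low_adj adj_sym; congr (_ && _); exact: andbC. Qed.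

Lemma low_adj_adj x y : low_adj x y -> adj x y.
Proof. by case/and3P. Qed.

Hypothesis c_gt0 : 0 < c.
Hypothesis edges_le : forall A B : {set G}, (edges_between A B)%:R <=
  c * ((#|A|)%:R * (#|B|)%:R `^ (alpha - 1) + N `^ beta).

Lemma low_adj_degree x : \sum_y (low_adj x y)%:R <= 2 * c * d.
Proof.
have [hx|lx] := boolP (x \in high_degree).
  rewrite big1 ?mulr_ge0 ?powR_ge0 ?(ltW c_gt0) // => y _.
  by rewrite /low_adj hx andbF.
apply: le_trans (_ : \sum_y (adj x y)%:R <= _); last first.
  by move: lx; rewrite inE -leNgt.
by apply: ler_sum => y _; rewrite ler_nat /low_adj; case: (adj x y); rewrite ?leq_b1.
Qed.

Lemma low_adj_between (A B : {set G}) :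
  \sum_(x in A) \sum_(y in B) (low_adj x y)%:R <=
  c * ((#|A|)%:R * (#|B|)%:R `^ (alpha - 1) + N `^ beta).
Proof.
apply: le_trans (edges_le A B); rewrite natr_sum; apply: ler_sum => x _.
rewrite natr_sum; apply: ler_sum => y _.
by rewrite ler_nat /low_adj; case: (adj x y); rewrite ?leq_b1.
Qed.

(** With H the set of high degree vertices, quasi-smoothness bounds the edges at H
    by c |H| d plus a lower order term, but by definition there are at least
    2 c |H| d of them. *)
Lemma high_degree_edges :
  \sum_(w : G * G | ~~ low_adj w.1 w.2) (adj w.1 w.2)%:R <= 4 * c * N `^ beta.
Proof.
pose E : R := \sum_(x in high_degree) \sum_y (adj x y)%:R.
have E_le : E <= 2 * c * N `^ beta.
  have up : E <= c * ((#|high_degree|)%:R * d + N `^ beta).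
    have := edges_le high_degree setT; rewrite cardsT; apply: le_trans.
    rewrite natr_sum; apply: ler_sum => x _; rewrite natr_sum.
    by rewrite le_eqVlt; apply/orP; left; apply/eqP; apply: eq_bigl => y; rewrite inE.
  have low : 2 * c * d * (#|high_degree|)%:R <= E.
    rewrite mulr_natr -sumr_const; apply: ler_sum => x.
    by rewrite inE => /ltW.
  have e1 : 2 * c * d * (#|high_degree|)%:R = 2 * (c * ((#|high_degree|)%:R * d)) by ring.
  by rewrite -mulrA; move: up low; rewrite e1 mulrDr; lra.
have -> : 4 * c * N `^ beta = 2 * c * N `^ beta + 2 * c * N `^ beta by ring.
apply: le_trans (_ : E + E <= _); last by rewrite lerD.
have -> : E = \sum_(w : G * G) (w.1 \in high_degree)%:R * (adj w.1 w.2)%:R.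
  rewrite /E big_mkcond -(pair_big xpredT xpredT
    (fun x y => (x \in high_degree)%:R * (adj x y)%:R)) /=.
  apply: eq_bigr => x _; rewrite -mulr_sumr.
  by case: (x \in _); rewrite ?mul1r ?mul0r.
have swap : involutive (fun w : G * G => (w.2, w.1)) by case.
rewrite [X in _ + X](reindex_inj (inv_inj swap)) /= -big_split big_mkcond.
apply: ler_sum => w _ /=; rewrite [adj w.2 w.1]adj_sym /low_adj.
case: (adj w.1 w.2); case: (w.1 \in _); case: (w.2 \in _) => /=;
  rewrite ?mulr0 ?mulr1 ?mul0r ?addr0 ?add0r ?lexx ?ler01 //.
by rewrite lerDl.
Qed.

End HighDegree.

(** * The removal statement *)

Section Constants.
Variable R : realType.

(** The cut-off for the block means: small enough a [th] for the first alternative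
    of [dense_blocks_few_edges], then [L] large enough for the second. *)
Lemma density_cutoff (alpha c eps : R) : 1 < alpha -> 0 < c -> 0 < eps ->
  exists th L : R, [/\ 0 < th <= 1, c * th `^ (alpha - 1) <= eps,
                       2 * c <= L * th & eps <= L].
Proof.
move=> a1 c0 eps0; have a10 : 0 < alpha - 1 by rewrite subr_gt0.
pose th := Num.min 1 ((eps / c) `^ (alpha - 1)^-1).
have ec0 : 0 < eps / c by rewrite divr_gt0.
have th0 : 0 < th by rewrite lt_min ltr01 powR_gt0.
exists th, (Num.max (2 * c / th) eps); split.
- by rewrite th0 ge_min lexx.
- rewrite mulrC -ler_pdivlMr //.
  apply: le_trans (_ : ((eps / c) `^ (alpha - 1)^-1) `^ (alpha - 1) <= _).
    rewrite ge0_ler_powR ?nnegrE ?(ltW a10) ?(ltW th0) ?powR_ge0 //.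
    by rewrite ge_min lexx orbT.
  by rewrite -powRrM mulVf ?gt_eqF // powRr1 // ltW.
- by rewrite -ler_pdivrMr // le_max lexx.
- by rewrite le_max lexx orbT.
Qed.

End Constants.

Theorem corollary1p7 (R : realType) (k : nat) (alpha beta : R)
    (F : graph_family) :
  (2 <= k)%N ->
  alpha < 2 -> beta < alpha -> 1 <= beta ->
  (forall H : sgraph, F H -> bipartite H) ->
  quasi_smooth alpha beta F ->
  forall epsilon C : R, 0 < epsilon -> 0 < C ->
  exists (n0 : nat) (delta : R), (0 < n0)%N /\ 0 < delta /\
  forall n : nat, (n0 <= n)%N ->
  forall G : sgraph, #|G| = n -> family_free F G ->
    (num_hom (cycle_graph (2 * k)) G)%:R
      <= C * n%:R `^ ((2 * k)%:R * (alpha - 1)) ->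
    (num_inj (cycle_graph (2 * k + 1)) G)%:R
      <= delta * n%:R `^ ((2 * k + 1)%:R * (alpha - 1)) ->
  exists D : {set {set G}},
    D \subset edges G /\ (#|D|)%:R <= epsilon * n%:R `^ alpha /\
    family_free (odd_cycles k) (del_edges D).
Proof.
move=> k2 a2 ba b1 _ qs epsilon C eps0 C0.
have k0 : (0 < k)%N by exact: ltnW.
have a1 : 1 < alpha by exact: le_lt_trans b1 ba.
have b0 : 0 <= beta by apply: le_trans b1.
have [c c0 edges_le] := quasi_smooth_edges a1 a2 b0 qs.
have rE : (2 * k + 1 = k.+1 + k)%N by lia.
have r0 : (0 < k.+1 + k)%N by [].
rewrite rE; have [r rE'] : exists r, r = (k.+1 + k)%N by exists (k.+1 + k)%N.
rewrite -rE' in r0 *.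
have rR : 0 < r%:R :> R by rewrite ltr0n.
(* The four kinds of bad blocks take at most eta n d edges each, and the terms in
   n^beta together take another eta n d. *)
pose eta := epsilon / 8; have eta0 : 0 < eta by rewrite divr_gt0.
have [th [L [th01 cth cL etaL]]] := density_cutoff a1 c0 eta0.
have L0 : 0 < L by exact: lt_le_trans etaL.
pose M := Num.max 1 (Num.max (2 * c) (2 * L)).
have M1 : 1 <= M by rewrite le_max lexx.
have cM : 2 * c <= M by rewrite !le_max lexx orbT.
have LM : 2 * L <= M by rewrite !le_max lexx !orbT.
pose kap := eta / (16 * r%:R ^+ 3).
have kap0 : 0 < kap by rewrite divr_gt0 // mulr_gt0 // exprn_gt0.
pose del := kap * eta / L.
have del0 : 0 < del by rewrite divr_gt0 // mulr_gt0.
pose g1 := eta / (4 * c); have g10 : 0 < g1 by rewrite divr_gt0 // mulr_gt0.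
pose g (m : nat) := g1 / m.+1%:R.
have g_gt0 m : 0 < g m by rewrite divr_gt0 // ltr0n.
pose rho (m : nat) := (eta / 2) ^+ r / 2 * (g m / (2 * r)%:R) ^+ r.
have rho0 m : 0 < rho m.
  apply: mulr_gt0; first by apply: divr_gt0 => //; apply/exprn_gt0/divr_gt0.
  by apply/exprn_gt0/divr_gt0 => //; rewrite ltr0n muln_gt0 r0.
have psi_ex m : exists psi, 0 < psi /\ transfers k (2 * L) M C (rho m) psi.
  have L20 : 0 < 2 * L by rewrite mulr_gt0.
  by have [psi psi0 tr] := counting_lemma k0 L20 LM M1 C0 (rho0 m); exists psi.
have [psi psi_ok] := choice psi_ex.
(* The precision psi m is small in terms of m, but m is bounded by Mx, so that
   rho Mx is a lower bound for every density that occurs. *)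
have [Mx reg] := @strong_regularity R (2 * c) L (2 * L) del psi
  (mulr_gt0 (ltr0Sn _ 1) c0) L0 (mulr_gt0 (ltr0Sn _ 1) L0) del0 (fun m => proj1 (psi_ok m)).
have x0 : 0 < eta / (4 * c + 2 * c * Mx%:R).
  by rewrite divr_gt0 // ltr_wpDr ?mulr_gt0 // mulr_ge0 // mulr_ge0 // ltW.
have [n1 n10 beta_small] := powR_eventually_le ba x0.
pose n2 := Num.bound (r%:R / g Mx).
exists (maxn n1 n2), (rho Mx / 4); split; first by rewrite leq_max n10.
split=> [|n nn G Gn Ffree]; first by rewrite divr_gt0.
subst n; set N : R := (#|G|)%:R; set d : R := N `^ (alpha - 1).
have V0 : (0 < #|G|)%N by apply: leq_trans nn; rewrite leq_max n10.
have N0 : 0 < N by rewrite ltr0n.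
have d0 : 0 < d by rewrite powR_gt0.
have powE j : N `^ (j%:R * (alpha - 1)) = d ^+ j.
  by rewrite mulrC powRrM powR_mulrn // ltW.
rewrite !powE => hom_le inj_le.
have NdE : N `^ alpha = N * d by rewrite mulr_powRB1 ?(ltW N0) // (lt_trans _ a1).
have Nbeta : (4 * c + 2 * c * Mx%:R) * N `^ beta <= eta * (N * d).
  rewrite -NdE mulrC -ler_pdivlMr; last first.
    by rewrite ltr_wpDr ?mulr_gt0 // mulr_ge0 // mulr_ge0 // ltW.
  rewrite mulrAC; apply: beta_small; apply: leq_trans nn.
  by rewrite leq_maxl.
have rgN : r%:R <= g Mx * N.
  rewrite mulrC -ler_pdivrMr //; apply: ltW.
  apply: lt_le_trans (archi_boundP _) _; first by rewrite divr_ge0 // ltW.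
  by rewrite ler_nat (leq_trans _ nn) // leq_maxr.
have Ele := edges_le G Ffree.
pose e := low_adj alpha c (G := G).
pose a x y : R := N / d * (e x y)%:R.
have aN x y : 0 <= a x y by rewrite mulr_ge0 // divr_ge0 // ltW.
have deg x : \sum_y (e x y)%:R <= 2 * c * d by exact: low_adj_degree.
have a_sum : \sum_(w : G * G) a w.1 w.2 <= 2 * c * N ^+ 2.
  rewrite -(pair_big xpredT xpredT a) /=.
  have -> : 2 * c * N ^+ 2 = N * (2 * c * N) by ring.
  rewrite -sum_cst; apply: ler_sum => x _; rewrite -mulr_sumr.
  apply: le_trans (ler_wpM2l _ (deg x)) _; first by rewrite divr_ge0 // ltW.
  by rewrite le_eqVlt; apply/orP; left; apply/eqP; field; rewrite gt_eqF.
have [m [T [T' [p [p' [h [mM Tm ph dev cut]]]]]]] := reg G a aN a_sum.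
pose u x y : R := `|block_mean p' a x y - block_mean p a x y|.
pose good x y := e x y && good_pair p e N d (g m) eta L kap u x y.
exists [set [set w.1; w.2] | w : G * G & adj w.1 w.2 && ~~ good w.1 w.2].
split; last split.
- apply/subsetP => W /imsetP[w]; rewrite inE => /andP[aw _] ->.
  by apply/imsetP; exists w; rewrite ?inE.
- apply: le_trans (_ : \sum_(w : G * G) (adj w.1 w.2 && ~~ good w.1 w.2)%:R <= _).
    rewrite -natr_sum ler_nat; apply: leq_trans (leq_imset_card _ _) _.
    rewrite -sum1_card big_mkcond leq_sum // => w _.
    by rewrite inE; case: ifP.
  have high := high_degree_edges Ele.
  have dense := dense_blocks_few_edges p V0 a1 c0 th01 cL (low_adj_between Ele).
  have Dnn : 0 <= 2 * c * d by rewrite !mulr_ge0 // ltW.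
  have u0 x y : 0 <= u x y by exact: normr_ge0.
  have bad := few_bad_pairs N0 d0 (ltW (g_gt0 m)) (erefl _)
    (@low_adj_sym R G alpha c) Dnn
    deg Tm (ltW eta0) kap0 (ltW L0) u0 dense dev.
  apply: le_trans (_ : \sum_(w : G * G | ~~ e w.1 w.2) (adj w.1 w.2)%:R +
     \sum_(w : G * G | ~~ good_pair p e N d (g m) eta L kap u w.1 w.2) (e w.1 w.2)%:R <= _).
    rewrite [X in _ <= X + _]big_mkcond [X in _ <= _ + X]big_mkcond -big_split.
    apply: ler_sum => w _ /=.
    rewrite /good; have := @low_adj_adj R G alpha c w.1 w.2; rewrite -/e.
    case: (e w.1 w.2) => [->|_] //=; case: (good_pair _ _ _ _ _ _ _ _ _ _ _) => //=;
      by rewrite ?addr0 ?add0r ?andbT.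
  apply: le_trans (lerD high bad) _.
  have Lk : L * (del / kap) = eta by rewrite /del; field; rewrite !gt_eqF.
  have gm : 2 * (m%:R * (g m * N)) * (2 * c * d) <= eta * (N * d).
    have -> : 2 * (m%:R * (g m * N)) * (2 * c * d) = m%:R * g m * (4 * c) * (N * d) by ring.
    rewrite ler_wpM2r ?mulr_ge0 ?(ltW N0) ?(ltW d0) //.
    have -> : m%:R * g m * (4 * c) = eta * (m%:R / m.+1%:R).
      have : 0 < m.+1%:R :> R by rewrite ltr0n.
      by rewrite /g /g1; move: (m.+1%:R : R) => q q0; field; rewrite !gt_eqF.
    by rewrite ger_pMr // ler_pdivrMr ?ltr0n // mul1r ler_nat.
  have dn : c * th `^ (alpha - 1) * (N * d) <= eta * (N * d).
    by rewrite ler_wpM2r // mulr_ge0 // ltW.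
  have tb : 2 * c * (#|T|)%:R * N `^ beta <= 2 * c * Mx%:R * N `^ beta.
    rewrite ler_wpM2r ?powR_ge0 // ler_wpM2l ?mulr_ge0 ?(ltW c0) //.
    by rewrite ler_nat (leq_trans Tm).
  rewrite NdE Lk; have -> : epsilon = 8 * eta by rewrite /eta; field.
  have end0 := mulr_ge0 (ltW eta0) (mulr_ge0 (ltW N0) (ltW d0)).
  have e1 : 8 * eta * (N * d) = 8 * (eta * (N * d)) by ring.
  move: gm dn tb end0 Nbeta; rewrite e1 -/N -/d -/e; lra.
move=> H [l lk ->] [f [_ f_hom]].
have Q_sym : symmetric (fun x y : G => good x y && good y x).
  by move=> x y; rewrite andbC.
have fQ i j : cycle_adj i j -> good (f i) (f j) && good (f j) (f i).
  move=> ij; have := implyP (forallP (forallP f_hom i) j) ij.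
  rewrite /= /del_adj => /andP[aij notD]; apply/andP; split; apply: contraT => ng;
    case/negP: notD; apply/imsetP.
    by exists (f i, f j); rewrite // inE /= aij.
  by exists (f j, f i); rewrite /= ?inE /= 1?adj_sym ?aij // setUC.
(* An odd cycle that survives gives too many injective homomorphisms. *)
have [s walk] := odd_closed_walk Q_sym lk fQ.
have walk_good i : (i < r)%N ->
    good_pair p e N d (g m) eta L kap u (s i) (s (i.+1 %% r)%N).
  by rewrite rE' => /walk /andP[/andP[_ ->]].
have g_le : g Mx <= g m.
  by rewrite ler_wpM2l ?(ltW g10) // lef_pV2 ?posrE ?ltr0n // ler_nat ltnS.
have rgmN : r%:R <= g m * N.
  by apply: le_trans rgN _; rewrite ler_wpM2r ?(ltW N0).
have degM x : \sum_y (e x y)%:R <= M * d.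
  by apply: le_trans (deg x) _; rewrite ler_wpM2r ?(ltW d0).
have low : rho m / 2 * d ^+ r <= (num_inj (cycle_graph r) G)%:R.
  have := @num_inj_of_good_closed_walk R G e T T' p p' k d (g m) eta L kap M C
    (psi m) s V0 k0 d0 (ltW (g_gt0 m)) eta0 etaL (@low_adj_sym R G alpha c)
    (@low_adj_adj R G alpha c) degM.
  rewrite -rE'; apply=> //; exact: (proj2 (psi_ok m)).
have rho_le : rho Mx <= rho m.
  apply: ler_wpM2l; first by rewrite divr_ge0 // exprn_ge0 // divr_ge0 // ltW.
  have r2 : 0 <= (2 * r)%:R^-1 :> R by rewrite invr_ge0.
  apply: lerXn2r; rewrite ?nnegrE ?(mulr_ge0 (ltW (g_gt0 _)) r2) //.
  by rewrite ler_wpM2r.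
have dr0 : 0 < d ^+ r by rewrite exprn_gt0.
have := le_trans low inj_le; rewrite ler_pM2r //.
by move: rho_le (rho0 m); lra.
Qed.
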